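(* Let $d=2m+1$ with $m\in\{0,1,2,\ldots\}$. Let $\alpha:\mathbb R^d\times[0,\infty)\to[0,\infty)$ and $\rho:[0,\infty)\to(0,\infty)$, and let $$u(\boldsymbol x,t)=\int_{\Omega_\rho(\boldsymbol x,t)}\alpha(\boldsymbol y,s)\,d\boldsymbol y\,ds\quad(\boldsymbol x\in\mathbb R^d,\ t\ge0),$$ $$\Omega_\rho(\boldsymbol x,t)=\Big\{(\boldsymbol y,s)\ \Big|\ 0<s<t,\ |\boldsymbol y-\boldsymbol x|<\int_s^t\rho(\tau)\,d\tau\Big\}.$$ Assume that $u(\boldsymbol x,t)\ge0$, $\alpha(\boldsymbol x,t)\ge0$ and $\rho(t)>0$ $(\boldsymbol x\in\mathbb R^d,\ t\ge0)$ are sufficiently smooth functions. Define the operator $$\mathcal P_\rho w(\boldsymbol x,t):=\frac1{\rho(t)}\,\partial_t\left(\frac{\partial_tw(\boldsymbol x,t)}{\rho(t)}\right)-\triangle w(\boldsymbol x,t).$$ Then $u$ satisfies $$\begin{cases}\mathcal P_\rho^{m+1}u(\boldsymbol x,t)=(2m)!!\,2^{m+1}\pi^m\,\alpha(\boldsymbol x,t)/\rho(t) & (\boldsymbol x\in\mathbb R^d,\ t>0),\\ \partial_t^ju(\boldsymbol x,0)=0,\quad j=0,1,\ldots,2m+1 & (\boldsymbol x\in\mathbb R^d).\end{cases}$$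
   Context: $\triangle$ is the Laplacian in the spatial variable $\boldsymbol x\in\mathbb R^d$. $\mathcal P_\rho^{m+1}$ denotes the $(m+1)$-fold composition of $\mathcal P_\rho$. $(2m)!!=2m(2m-2)\cdots 2$, with $0!!=1$. ''Sufficiently smooth'' means possessing as many continuous derivatives (up to $t=0$) as are needed. *)

(* Defs.v *)
From HB Require Import structures.
From mathcomp Require Import all_boot all_order all_algebra.
From mathcomp Require Import all_classical all_reals all_analysis.

Set Implicit Arguments.
Unset Strict Implicit.
Unset Printing Implicit Defensive.

Import Order.TTheory GRing.Theory Num.Theory.
Import numFieldNormedType.Exports.

Local Open Scope classical_set_scope.
Local Open Scope ring_scope.

Definition measure_rV_display : measure_display.
Proof. exact: default_measure_display. Qed.

(* The sigma-algebra on R^n generated by the n coordinate projections, that is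
   the Borel sigma-algebra. *)
Section measurable_rV.
Variables (R : realType) (n : nat).

Definition coord_rV (i : 'I_n) (x : 'rV[R]_n) : measurableTypeR R := x 0 i.

Let rV_set0 : g_sigma_preimage coord_rV set0.
Proof. exact: sigma_algebra0. Qed.

Let rV_setC A : g_sigma_preimage coord_rV A -> g_sigma_preimage coord_rV (~` A).
Proof. exact: sigma_algebraC. Qed.

Let rV_bigcup (F : (set 'rV[R]_n)^nat) :
  (forall i, g_sigma_preimage coord_rV (F i)) ->
  g_sigma_preimage coord_rV (\bigcup_i (F i)).
Proof. exact: sigma_algebra_bigcup. Qed.

HB.instance Definition _ := @isMeasurable.Build measure_rV_display
  'rV[R]_n (g_sigma_preimage coord_rV) rV_set0 rV_setC rV_bigcup.

End measurable_rV.

Section measurable_fun_rV.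
Variable R : realType.

Lemma measurable_coord_rV n (i : 'I_n) :
  measurable_fun [set: 'rV[R]_n] (@coord_rV R n i).
Proof.
move=> _ Y mY; rewrite setTI; apply: sub_sigma_algebra => /=.
rewrite -bigcup_seq/=; exists i => /=; first by rewrite mem_index_enum.
by exists Y => //; rewrite setTI.
Qed.

Lemma measurable_fun_rVP d (T : measurableType d) n (f : T -> 'rV[R]_n) :
  (forall i, measurable_fun [set: T] (@coord_rV R n i \o f)) ->
  measurable_fun [set: T] f.
Proof.
move=> mf _ Y mY; rewrite setTI.
suff : (g_sigma_preimage (@coord_rV R n)) `<=` [set A | measurable (f @^-1` A)].
  by apply.
apply: smallest_sub.
  split=> /=; first by rewrite preimage_set0.
    by move=> A mA; rewrite setTD -preimage_setC; exact: measurableC.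
  by move=> F mF; rewrite preimage_bigcup; exact: bigcup_measurable.
rewrite -bigcup_seq => A [i _ [B mB <-]] /=.
by rewrite setTI -[X in measurable X]setTI; exact: mf.
Qed.

End measurable_fun_rV.

Section lebesgue_rV.
Variable R : realType.

Definition cons_rV n (p : measurableTypeR R * 'rV[R]_n) : 'rV[R]_(1 + n) :=
  row_mx (const_mx p.1) p.2.

Lemma cons_rV0 n p : @cons_rV n p 0 ord0 = p.1.
Proof.
have -> : ord0 = lshift n 0 :> 'I_(1 + n) by exact: val_inj.
by rewrite row_mxEl mxE.
Qed.

Lemma cons_rV_lift n p i : @cons_rV n p 0 (lift ord0 i) = p.2 0 i.
Proof.
have -> : lift ord0 i = rshift 1 i :> 'I_(1 + n) by exact: val_inj.
by rewrite row_mxEr.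
Qed.

Lemma measurable_cons_rV n : measurable_fun setT (@cons_rV n).
Proof.
apply: measurable_fun_rVP => i.
rewrite -(splitK i); case: (fintype.split i) => j /=.
  rewrite (_ : _ \o _ = fst)//.
  by apply/funext => p /=; rewrite /coord_rV /cons_rV row_mxEl mxE.
rewrite (_ : _ \o _ = @coord_rV R n j \o snd).
  by apply: measurableT_comp => //; exact: measurable_coord_rV.
by apply/funext => p /=; rewrite /coord_rV /cons_rV row_mxEr.
Qed.

Definition uncons_rV n (x : 'rV[R]_(1 + n)) : measurableTypeR R * 'rV[R]_n :=
  (lsubmx x 0 0, rsubmx x).

Lemma cons_rVK n : cancel (@cons_rV n) (@uncons_rV n).
Proof.
by case=> a x; rewrite /uncons_rV /cons_rV row_mxKl row_mxKr mxE.
Qed.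

Lemma measurable_uncons_rV n : measurable_fun setT (@uncons_rV n).
Proof.
apply/measurable_fun_pairP; split.
  rewrite (_ : _ \o _ = @coord_rV R (1 + n) (lshift n 0)).
    exact: measurable_coord_rV.
  by apply/funext => x /=; rewrite mxE.
apply: measurable_fun_rVP => i.
rewrite (_ : _ \o _ = @coord_rV R (1 + n) (rshift 1 i)).
  exact: measurable_coord_rV.
by apply/funext => x /=; rewrite /coord_rV mxE.
Qed.

HB.instance Definition _ n := isMeasurableFun.Build _ _ _ _ (@cons_rV n)
  (@measurable_cons_rV n).

Section cons_measure.
Local Open Scope ereal_scope.
Variables (n : nat) (mu : {sigma_finite_measure set 'rV[R]_n -> \bar R}).

Definition cons_measure : set 'rV[R]_(1 + n) -> \bar R :=
  pushforward (lebesgue_measure \x mu) (@cons_rV n).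

Let cons_measure0 : cons_measure set0 = 0.
Proof. exact: measure0. Qed.

Let cons_measure_ge0 A : 0 <= cons_measure A.
Proof. exact: measure_ge0. Qed.

Let cons_measure_sigma_additive : semi_sigma_additive cons_measure.
Proof. exact: measure_semi_sigma_additive. Qed.

HB.instance Definition _ := isMeasure.Build _ _ _ cons_measure
  cons_measure0 cons_measure_ge0 cons_measure_sigma_additive.

Let cons_measure_sigma_finite : sigma_finite setT cons_measure.
Proof.
have /sigma_finiteP[F [TF ndF Foo]] := sigma_finiteT (@lebesgue_measure R).
have /sigma_finiteP[G [TG ndG Goo]] := sigma_finiteT mu.
exists (fun k => @uncons_rV n @^-1` (F k `*` G k)).
  rewrite -preimage_bigcup (_ : \bigcup_i _ = setT) ?preimage_setT//.
  rewrite -setXTT TF TG predeqE => -[x y]; split.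
    by move=> [n' _ []/= ? ?]; split; exists n'.
  move=> [/= [p _ Fpx] [q _ Gqy]]; exists (maxn p q) => //; split.
  - by move: x Fpx; exact/subsetPset/ndF/leq_maxl.
  - by move: y Gqy; exact/subsetPset/ndG/leq_maxr.
move=> k; have [mF Fk] := Foo k; have [mG Gk] := Goo k; split.
  rewrite -[X in measurable X]setTI; apply: measurable_uncons_rV => //.
  exact: measurableX.
rewrite /cons_measure /pushforward -comp_preimage.
rewrite (_ : _ \o _ = idfun); last by apply/funext => p /=; rewrite cons_rVK.
by rewrite preimage_id product_measure1E// lte_mul_pinfty// ge0_fin_numE.
Qed.

HB.instance Definition _ := Measure_isSigmaFinite.Build _ _ _ cons_measure
  cons_measure_sigma_finite.

End cons_measure.

(* Lebesgue measure on R^n, R^(1 + n) being identified with R * R^n. *)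
Fixpoint lebesgue_rV n : {sigma_finite_measure set 'rV[R]_n -> \bar R} :=
  match n with
  | 0 => \d_(0 : 'rV[R]_0)
  | n'.+1 => cons_measure (lebesgue_rV n')
  end.

Lemma measurable_box_rV n (A : 'I_n -> set (measurableTypeR R)) :
  (forall i, measurable (A i)) ->
  measurable [set x : 'rV[R]_n | forall i, A i (x 0 i)].
Proof.
move=> mA; rewrite (_ : mkset _ = \big[setI/setT]_(i < n) (@coord_rV R n i @^-1` A i)).
  apply: bigsetI_measurable => i _; rewrite -[X in measurable X]setTI.
  exact: measurable_coord_rV.
rewrite -bigcap_seq; apply/seteqP; split => x /= Ax; first by move=> i _; exact: Ax.
by move=> i; apply: Ax; rewrite /= mem_index_enum.
Qed.

Lemma lebesgue_rV_box n (A : 'I_n -> set (measurableTypeR R)) :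
  (forall i, measurable (A i)) ->
  lebesgue_rV n [set x | forall i, A i (x 0 i)] =
  (\prod_(i < n) lebesgue_measure (A i))%E.
Proof.
elim: n A => [|n IHn] A mA.
  by rewrite big_ord0 /= diracE mem_set//= => -[].
rewrite big_ord_recl -IHn//= /cons_measure /pushforward -product_measure1E//.
  congr product_measure1; apply/seteqP; split => -[a x] /=.
    move=> Aax; split; first by have := Aax ord0; rewrite cons_rV0.
    by move=> i; have := Aax (lift ord0 i); rewrite cons_rV_lift.
  move=> [Aa Ax] i; have [j ->|->] := unliftP ord0 i.
    by rewrite cons_rV_lift; exact: Ax.
  by rewrite cons_rV0.
exact: (@measurable_box_rV n (fun i => A (lift ord0 i)) (fun i => mA _)).
Qed.

End lebesgue_rV.

Section halfspace.
Variable R : realType.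

(* Differentiation on [0, +oo[ : two-sided at t > 0, right-sided at t = 0.
   The values of f at negative arguments play no role. *)
Definition half_dquot (f : R -> R) (t : R) : set_system R :=
  h^-1 * (f (h + t) - f t) @[h --> within [set h | 0 <= h + t] 0^'].

Definition half_derivable (f : R -> R) (t : R) : Prop := cvg (half_dquot f t).

Definition half_derive (f : R -> R) (t : R) : R := lim (half_dquot f t).

Fixpoint half_line_C (N : nat) (f : R -> R) : Prop :=
  {within [set t | 0 <= t], continuous f} /\
  match N with
  | 0 => True
  | N'.+1 => (forall t, 0 <= t -> half_derivable f t) /\
             half_line_C N' (half_derive f)
  end.

Variable d : nat.
Implicit Types (w : 'rV[R]_d -> R -> R) (x : 'rV[R]_d) (t : R).

Definition dt w x t : R := half_derive (w x) t.

Definition dx (i : 'I_d) w x t : R := 'D_(delta_mx 0 i) (w ^~ t) x.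

(* w is C^N on R^d x [0, +oo[ : all mixed partial derivatives of order at most
   N exist and are continuous there. *)
Fixpoint half_space_C (N : nat) w : Prop :=
  {within [set p : 'rV[R]_d * R | 0 <= p.2], continuous (fun p => w p.1 p.2)} /\
  match N with
  | 0 => True
  | N'.+1 =>
      [/\ forall x t, 0 <= t -> half_derivable (w x) t,
          forall i x t, 0 <= t -> derivable (w ^~ t) x (delta_mx 0 i),
          half_space_C N' (dt w) &
          forall i, half_space_C N' (dx i w)]
  end.

Definition laplacian w x t : R := \sum_(i < d) dx i (dx i w) x t.

Definition wave_op (rho : R -> R) w x t : R :=
  (rho t)^-1 * dt (fun y s => dt w y s / rho s) x t - laplacian w x t.

(* The norm of the library on 'rV[R]_d is the sup norm. *)
Definition euclidean_norm x : R := Num.sqrt (\sum_(i < d) x 0 i ^+ 2).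

Definition past_cone (rho : R -> R) x t : set ('rV[R]_d * R) :=
  [set p | 0 < p.2 < t /\
    euclidean_norm (p.1 - x) <
      \int[lebesgue_measure]_(tau in `[p.2, t]) rho tau].

Definition cone_integral (rho : R -> R) (alpha : 'rV[R]_d -> R -> R) x t : R :=
  \int[(lebesgue_rV R d \x lebesgue_measure)%E]_(p in past_cone rho x t)
    alpha p.1 p.2.

End halfspace.

Arguments dt {R d}.

Fixpoint double_fact (n : nat) : nat :=
  if n is n'.+2 then (n * double_fact n')%N else 1%N.

(* Main.v *)
Require Import Defs.
From HB Require Import structures.
From mathcomp Require Import all_boot all_order all_algebra.
From mathcomp Require Import all_classical all_reals all_analysis.
From mathcomp Require Import measurable_realfun lebesgue_integral_under.
From mathcomp Require Import ring lra zify.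

Set Implicit Arguments.
Unset Strict Implicit.
Unset Printing Implicit Defensive.

Import Order.TTheory GRing.Theory Num.Theory.
Import numFieldNormedType.Exports.

Local Open Scope classical_set_scope.
Local Open Scope ring_scope.

(** Why the theorem holds.

    Let [P] be an antiderivative of [rho] and let [R = P t - P s] be the radius at
    time [s] of the backward cone with vertex [(x, t)]. By Tonelli ([cone_integralE])
    the function [u] is the integral over [0 <= s <= t] of [R ^+ d] times the mean
    of [alpha] over the unit ball dilated by [R] and centred at [x]. Dividing a
    time derivative by [rho t] amounts to differentiating in [R], up to the
    contribution of the moving endpoint [s = t], where [R = 0]. So everything
    depends on how the ball means of a function [f] behave in the radius [r].

    Let [weight z = (1 - |z|^2) / 2], let [Psi f] and [Phi f] be the integrals over
    the unit ball of [weight z * f (x + r z)] and of [f (x + r z)]. As [weight]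
    vanishes on the sphere and has gradient [- z], integration by parts gives
    [d/dr Phi f = r Psi (lap f)] and [r d/dr Psi f = Phi f - (d + 2) Psi f]
    ([ball_mean_is_derive], [weighted_mean_is_derive]). Put [H_0 = Psi], [H_1 = Phi]
    and [H_{k+2} f = (d - 2 k) H_{k+1} f + r^2 H_k (lap f)]. Then for all [k]
      [d/dr H_{k+1} f = r H_k (lap f)]        ([ladder_is_derive]),
      [d/dr (r^(d-2k) H_{k+1} f) = r^(d-2k-1) H_{k+2} f].
    Let [u_k] be the integral of [R^(d-2k) H_{k+1} alpha] over [0 <= s <= t], so that
    [u_0 = u]. Two time derivatives of [u_k] produce the integral of
    [R^(d-2k) H_{k+1} (lap alpha)], which is the Laplacian of [u_k], plus
    [(d - 2 k - 1) u_{k+1}]. Hence the wave operator maps [u_k] to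
    [(2 m - 2 k) u_{k+1}] as long as [k < m]. At [k = m] the exponent [d - 2 m] is
    one, the factor [2 m - 2 k] is zero, and the second derivative meets the
    endpoint: what is left is [H_{m+2} alpha / rho] at [r = 0]
    ([wave_op_cone_mean]). There all terms with [r^2] vanish, so its value is
    [d (d - 2) ... 1] times the volume of the unit ball times [alpha / rho]
    ([ladder_center]). The factors [2 m - 2 k] multiply up to [(2 m)!!], and
    [d!!] times the volume is [2^(m+1) pi^m] by the two-step recursion for
    volumes of balls ([odd_ball_volume]).

    For the initial data, [|u (x, t)| <= C t^(d+1)] for small [t]
    ([cone_mean_bound]); as [u] is smooth up to [t = 0], Taylor's formula
    ([derivatives_vanish]) kills its time derivatives of order at most
    [d = 2 m + 1]. *)

(** * Continuity and measurability *)

Section continuity_closure.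
Variables (K : numFieldType) (V : normedModType K) (T : topologicalType).

Lemma continuous_add (f g : T -> V) :
  continuous f -> continuous g -> continuous (fun x => f x + g x).
Proof. by move=> cf cg x; apply: cvgD; [exact: cf|exact: cg]. Qed.

Lemma continuous_sub (f g : T -> V) :
  continuous f -> continuous g -> continuous (fun x => f x - g x).
Proof. by move=> cf cg x; apply: cvgB; [exact: cf|exact: cg]. Qed.

Lemma continuous_scale (s : T -> K) (f : T -> V) :
  continuous s -> continuous f -> continuous (fun x => s x *: f x).
Proof. by move=> cs cf x; apply: cvgZ; [exact: cs|exact: cf]. Qed.

Lemma continuous_mul (f g : T -> K) :
  continuous f -> continuous g -> continuous (fun x => f x * g x).
Proof. by move=> cf cg x; apply: cvgM; [exact: cf|exact: cg]. Qed.

Lemma continuous_exp (f : T -> K) k :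
  continuous f -> continuous (fun x => f x ^+ k).
Proof.
move=> cf; elim: k => [|k IHk]; first by move=> x; exact: cvg_cst.
rewrite (_ : (fun x => _) = (fun x => f x * f x ^+ k)).
  exact: continuous_mul.
by apply/funext => x; rewrite exprS.
Qed.

Lemma continuous_sum (I : Type) (r : seq I) (f : I -> T -> V) :
  (forall i, continuous (f i)) -> continuous (fun x => \sum_(i <- r) f i x).
Proof.
move=> cf; elim: r => [|i r IHr].
  by under eq_fun do rewrite big_nil; move=> x; exact: cvg_cst.
by under eq_fun do rewrite big_cons; exact: continuous_add.
Qed.

End continuity_closure.

Section continuity_pairing.
Variables (T U W : topologicalType).

Lemma continuous_pair (f : T -> U) (g : T -> W) :
  continuous f -> continuous g -> continuous (fun x => (f x, g x)).
Proof. by move=> cf cg x; apply: cvg_pair; [exact: cf|exact: cg]. Qed.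

Lemma continuous_compose (f : T -> U) (g : U -> W) :
  continuous f -> continuous g -> continuous (fun x => g (f x)).
Proof. by move=> cf cg x; apply: continuous_comp; [exact: cf|exact: cg]. Qed.

Lemma fst_continuous : continuous (@fst T U).
Proof. by move=> p; exact: cvg_fst. Qed.

Lemma snd_continuous : continuous (@snd T U).
Proof. by move=> p; exact: cvg_snd. Qed.

End continuity_pairing.

Section continuous_is_measurable.
Variables (R : realType) (n : nat).
Local Notation V := ('rV[R]_n).

(** The sigma-algebra is generated by coordinates while the topology comes from
    the sup norm; they agree because every open set is a countable union of
    cubes with rational centre and radius [1 / k.+1]. *)
Lemma open_measurable_rV_prod (U : set (V * R)) :
  open U -> measurable (U : set (V * measurableTypeR R)).
Proof.
move=> oU.
pose B (i : 'rV[rat]_n * rat * nat) : set (V * R) :=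
  [set p : V * R | (forall j, ball (ratr (i.1.1 0 j) : R) (i.2.+1%:R^-1 : R) (p.1 0 j)) /\
           ball (ratr i.1.2 : R) (i.2.+1%:R^-1 : R) p.2].
have mball (c e : R) : measurable (ball c e : set (measurableTypeR R)).
  by rewrite ball_itv; exact: measurable_itv.
have mB i : measurable (B i : set (V * measurableTypeR R)).
  rewrite (_ : B i = [set x : V | forall j, ball (ratr (i.1.1 0 j) : R) (i.2.+1%:R^-1 : R) (x 0 j : R)]
    `*` (ball (ratr i.1.2 : R) (i.2.+1%:R^-1 : R))); last by apply/seteqP; split.
  apply: measurableX; last exact: mball.
  by apply: (@measurable_box_rV _ _ (fun j => ball (ratr (i.1.1 0 j) : R) (i.2.+1%:R^-1 : R))) => j; exact: mball.
pose J := [set i | B i `<=` U].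
rewrite (_ : U = \bigcup_(i in J) B i); last first.
  apply/seteqP; split=> [[x t] Uxt|p [i Ji Bip]]; last exact: Ji.
  have /nbhs_ballP[e /= e0 eU] : nbhs (x, t) U by exact: open_nbhs_nbhs.
  have [k /= ke] : exists k, k.+1%:R^-1 + k.+1%:R^-1 < e.
    have e20 : 0 < e / 2 by rewrite divr_gt0.
    have [k _ kP] := near_infty_natSinv_lt (PosNum e20).
    by exists k; rewrite [ltRHS]splitr ltrD//; exact: (kP k (leqnn k)).
  have rat_near (y : R) : exists q : rat, ball (ratr q : R) (k.+1%:R^-1 : R) y.
    have /rat_in_itvoo[q] : y - k.+1%:R^-1 < y + k.+1%:R^-1.
      by rewrite ltrD2l gtrN// invr_gt0.
    rewrite in_itv/= => /andP[q1 q2]; exists q.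
    by rewrite /ball/= ltr_distl q1 q2.
  have /choice[f fP] := fun j => rat_near (x 0 j).
  have [q qt] := rat_near t.
  exists (\row_j f j, q, k) => /=; last first.
    by split=> // j; rewrite mxE.
  move=> [y s] /= [By Bs]; apply: eU; split => /=.
    split=> // i j; rewrite (ord1 i).
    apply: le_ball (ltW ke) _ _.
    by apply: ball_triangle (ball_sym (fP j)) _; have := By j; rewrite /= mxE.
  by apply: le_ball (ltW ke) _ _; exact: ball_triangle (ball_sym qt) _.
rewrite bigcup_mkcond; apply: countable_bigcupT_measurable => // i.
by case: ifP.
Qed.

Lemma continuous_measurable_rV_prod (f : V * R -> R) :
  continuous f -> measurable_fun setT (f : V * measurableTypeR R -> R).
Proof.
move=> /continuousP cf; apply: (measurability _ (RGenOpens.measurableE R)).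
move=> _ [_ [a [b ->] <-]]; rewrite setTI; apply: open_measurable_rV_prod.
exact/cf/interval_open.
Qed.

Lemma continuous_measurable_rV (f : V -> R) :
  continuous f -> measurable_fun setT f.
Proof.
move=> cf.
have -> : f = (f \o fst) \o (fun x : V => (x, 0 : measurableTypeR R)) by [].
apply: measurableT_comp; last exact: measurable_fun_pair.
apply: continuous_measurable_rV_prod => p.
by apply: continuous_comp; [exact: cvg_fst|exact: cf].
Qed.

End continuous_is_measurable.

Section uniformity_over_compacts.
Variables (R : realType) (X Y : topologicalType).

(** The tube lemma in metric form: continuity in the parameter is uniform over
    a compact set of integration variables. All passages to the limit under an
    integral sign below rest on it. *)
Lemma near_compact_uniform (f : X * Y -> R) (K : set Y) x0 :
  compact K -> continuous f -> forall e, 0 < e ->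
  \forall x \near x0, forall y, K y -> `|f (x, y) - f (x0, y)| < e.
Proof.
move=> /compact_near_coveringP cK cf e e0.
apply: (cK X (nbhs x0) (fun x y => `|f (x, y) - f (x0, y)| < e)) => y Ky.
have e20 : 0 < e / 2 by rewrite divr_gt0.
have /cvgrPdist_lt /(_ _ e20) [[/= U W] [Uy Wx] UW] : f z @[z --> (x0, y)] --> f (x0, y).
  exact: cf.
exists (W, U) => //= -[y' x] /= [Wy' Ux].
rewrite (splitr e) (le_lt_trans (ler_distD (f (x0, y)) _ _))// ltrD//.
  by rewrite distrC; apply: (UW (x, y')).
by apply: (UW (x0, y')); split => //; exact: nbhs_singleton.
Qed.

End uniformity_over_compacts.

(** * Differentiation in one variable and along lines *)

(** Stated for pointwise sums and products, these rules unify with derivatives of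
    explicit formulas. *)
Section pointwise_derivation.
Variables (R : realType) (V : normedModType R) (x v : V).

Lemma is_derive_addf (f g : V -> R) df dg :
  is_derive x v f df -> is_derive x v g dg ->
  is_derive x v (fun y => f y + g y) (df + dg).
Proof. exact: is_deriveD. Qed.

Lemma is_derive_mulf (f g : V -> R) df dg :
  is_derive x v f df -> is_derive x v g dg ->
  is_derive x v (fun y => f y * g y) (f x * dg + g x * df).
Proof. exact: is_deriveM. Qed.

Lemma is_derive_mulcf (c : R) (f : V -> R) df :
  is_derive x v f df -> is_derive x v (fun y => c * f y) (c * df).
Proof. exact: is_deriveZ. Qed.

Lemma is_derive_expf (f : V -> R) df n :
  is_derive x v f df ->
  is_derive x v (fun y => f y ^+ n) (n%:R * f x ^+ n.-1 * df).
Proof.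
move=> fdf; have := is_deriveX n fdf; congr (is_derive _ _ _ _).
by apply/funext => y; elim: n => [|n IHn]; rewrite ?expr0// !exprS -IHn.
Qed.

End pointwise_derivation.

Section derivative_along_lines.
Variables (R : realType) (V : normedModType R).

Lemma is_derive_line (f : V -> R) (y v : V) (a l : R) :
  is_derive (y + a *: v) v f l <-> is_derive a 1 (fun b : R => f (y + b *: v)) l.
Proof.
have E : (fun h => h^-1 *: ((f \o shift (y + a *: v)) (h *: v) - f (y + a *: v))) =
    (fun h => h^-1 *: (((fun b => f (y + b *: v)) \o shift a) (h *: (1 : R))
       - f (y + a *: v))).
  apply/funext => h /=; congr (_ *: (f _ - _)).
  by rewrite [h *: (1 : R)]mulr1 scalerDl addrCA addrC -addrA [a *: v + _]addrC.
have D1 : derivable f (y + a *: v) v = derivable (fun b : R => f (y + b *: v)) a 1 :=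
  congr1 (fun q : R -> R => cvg (q h @[h --> 0^'])) E.
have D2 : 'D_v f (y + a *: v) = 'D_1 (fun b : R => f (y + b *: v)) a :=
  congr1 (fun q : R -> R => lim (q h @[h --> 0^'])) E.
split=> -[df dE]; split; [by rewrite -D1|by rewrite -D2|by rewrite D1|by rewrite D2].
Qed.

End derivative_along_lines.

Section one_variable.
Variable R : realType.

Lemma is_derive1P (f : R -> R) (t l : R) :
  is_derive t 1 f l <-> h^-1 * (f (h + t) - f t) @[h --> 0^'] --> l.
Proof.
have -> : (fun h => h^-1 * (f (h + t) - f t)) =
    (fun h => h^-1 *: ((f \o shift t) (h *: (1 : R)) - f t)).
  by apply/funext => h /=; rewrite [h *: _]mulr1.
split=> [[df <-]|dfl]; first exact: df.
split; first by apply/cvg_ex; exists l.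
by apply/cvg_lim => //; exact: Rhausdorff.
Qed.

Lemma is_derive_integral_upper (f : R -> R) (a t : R) : continuous f -> a < t ->
  is_derive t 1 (fun t => \int[lebesgue_measure]_(x in `[a, t]) f x) (f t).
Proof.
move=> cf at_; have tt1 : t < t + 1 by rewrite ltrDl.
have itf : lebesgue_measure.-integrable `[a, t + 1] (EFin \o f).
  apply: continuous_compact_integrable; first exact: segment_compact.
  exact: continuous_subspaceT.
have [||df dfE] := @continuous_FTC1_closed R f a t (t + 1) tt1 itf.
- exact: at_.
- exact: cf.
by split; [exact: df|rewrite -derive1E].
Qed.

(** The mean value theorem for an increment [h] of either sign. *)
Lemma increment_mvt (f df : R -> R) (t h : R) :
  (forall x, `|x - t| <= `|h| -> is_derive x 1 f (df x)) ->
  exists2 c, `|c - t| <= `|h| & f (h + t) - f t = h * df c.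
Proof.
move=> fdf; have [h0|h0] := leP 0 h.
  have [|x||c] := @MVT_segment _ f df t (h + t); first by rewrite lerDr.
  - rewrite in_itv/= => /andP[xt xh]; apply: fdf; rewrite !ger0_norm//; lra.
  - apply: derivable_within_continuous => x; rewrite in_itv/= => /andP[xt xh].
    by apply: ex_derive; apply: fdf; rewrite !ger0_norm//; lra.
  rewrite in_itv/= => /andP[ct ch] E; exists c; last by rewrite E addrK mulrC.
  by rewrite !ger0_norm//; lra.
have [|x||c] := @MVT_segment _ f df (h + t) t; first by rewrite gerDr ltW.
- by rewrite in_itv/= => /andP[xt xh]; apply: fdf; rewrite !ler0_norm//; lra.
- apply: derivable_within_continuous => x; rewrite in_itv/= => /andP[xt xh].
  by apply: ex_derive; apply: fdf; rewrite !ler0_norm//; lra.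
rewrite in_itv/= => /andP[ct ch] E; exists c; last by lra.
by rewrite !ler0_norm//; lra.
Qed.

(** The chain rule along the diagonal. Only the derivative in the first variable
    must exist nearby and be continuous: the mean value theorem turns the
    increment in that variable into a value of [q] near [(t, t)], and the other
    increment is taken at the fixed first argument [t]. It yields both the
    multivariate chain rule, one coordinate at a time, and Leibniz' rule for an
    integral whose endpoint moves. *)
Lemma is_derive_diagonal (W : R -> R -> R) (q : R * R -> R) (t d v : R) :
  0 < d -> (forall a b, `|a - t| < d -> is_derive a 1 (W^~ b) (q (a, b))) ->
  {for (t, t), continuous q} -> is_derive t 1 (W t) v ->
  is_derive t 1 (fun b => W b b) (q (t, t) + v).
Proof.
move=> d0 Wq cq /is_derive1P Wv; apply/is_derive1P.
rewrite (_ : (fun h => _) = (fun h => h^-1 * (W (h + t) (h + t) - W t (h + t))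
    + h^-1 * (W t (h + t) - W t t))); last first.
  by apply/funext => h; rewrite -mulrDr; congr (_ * _); ring.
apply: cvgD => //; apply/cvgrPdist_le => /= e e0.
have /cvgrPdist_lt /(_ _ e0) /nbhs_ballP[r /= r0 rq] := cq.
have m0 : 0 < Num.min r d by rewrite lt_min r0 d0.
exists (Num.min r d) => //= h /=; rewrite sub0r normrN lt_min => /andP[hr hd] h0.
have [c ct ->] := @increment_mvt (W^~ (h + t)) (fun a => q (a, h + t)) t h
  (fun x xt => Wq x (h + t) (le_lt_trans xt hd)).
rewrite mulKf//; apply/ltW/rq; split => /=.
  by rewrite /ball/= distrC (le_lt_trans ct).
by rewrite /ball/= opprD addrCA subrr addr0 normrN.
Qed.

Lemma half_line_antiderivative (f : R -> R) : continuous f ->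
  exists F : R -> R, [/\ continuous F, forall t : R, 0 < t -> is_derive t 1 F (f t) &
    forall s t, 0 <= s -> s <= t ->
      \int[lebesgue_measure]_(x in `[s, t]) f x = F t - F s].
Proof.
move=> cf.
(* Starting at -1 makes the integral differentiable at 0 as well. *)
pose A (t : R) := \int[lebesgue_measure]_(x in `[-1, t]) f x.
pose F (t : R) := A (Num.max t 0).
have dA (t : R) : -1 < t -> is_derive t 1 A (f t) by exact: is_derive_integral_upper.
have FA t : 0 <= t -> F t = A t by move=> t0; rewrite /F; congr A; apply/max_idPl.
exists F; split.
- move=> t; apply: (@continuous_comp _ _ _ (fun t : R => Num.max t 0) A).
    by apply: continuous_max; [exact: cvg_id|exact: cvg_cst].
  apply: differentiable_continuous; apply/derivable1_diffP.
  have m1 : -1 < Num.max t 0 by rewrite lt_max ltrN10 orbT.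
  by case: (dA _ m1).
- move=> t t0; apply: (near_eq_is_derive (f := A)).
    near=> y; apply/esym/FA/ltW; near: y; exact: lt_nbhsr.
  by apply: dA; lra.
- move=> s t s0 st; rewrite !FA//; last by lra.
  have itf a b : lebesgue_measure.-integrable `[a, b] (EFin \o f).
    apply: continuous_compact_integrable; first exact: segment_compact.
    exact: continuous_subspaceT.
  rewrite /A (@Rintegral_itvB _ _ (BLeft (-1)) (BRight t) s)//.
    rewrite Rintegral_itv_obnd_cbnd//.
    by apply: (integrableS _ _ _ (itf s t)) => //; exact: subset_itv_oc_cc.
  by rewrite bnd_simp; lra.
Unshelve. all: by end_near. Qed.

End one_variable.

(** * Integrals depending on a parameter *)

Lemma Rintegral_sum (R : realType) (dd : measure_display) (Y : measurableType dd)
    (mu : {measure set Y -> \bar R}) (D : set Y) (I : Type) (r : seq I)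
    (g : I -> Y -> R) : measurable D ->
  (forall i, mu.-integrable D (EFin \o g i)) ->
  \int[mu]_(y in D) \sum_(i <- r) g i y = \sum_(i <- r) \int[mu]_(y in D) g i y.
Proof.
move=> mD ig.
suff [] : mu.-integrable D (EFin \o (fun y => \sum_(i <- r) g i y)) /\
    \int[mu]_(y in D) \sum_(i <- r) g i y = \sum_(i <- r) \int[mu]_(y in D) g i y by [].
elim: r => [|i r [ir IHr]].
  rewrite big_nil; under eq_Rintegral do rewrite big_nil.
  rewrite Rintegral_cst// mul0r; split=> //.
  rewrite (_ : _ \o _ = cst 0%E); first exact: integrable0.
  by apply/funext => y /=; rewrite big_nil.
rewrite big_cons; under eq_Rintegral do rewrite big_cons.
rewrite RintegralD// IHr; split=> //.
rewrite (_ : _ \o _ = (EFin \o g i) \+ (EFin \o (fun y => (\sum_(j <- r) g j y)%R)))%E.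
  exact: integrableD.
by apply/funext => y /=; rewrite big_cons EFinD.
Qed.

(** A measurable structure on [Y] and a topology on [T] are given separately and
    linked by [i]: in the applications [i] is the identity of a carrier that has
    both. *)
Section integral_with_parameter.
Variables (R : realType) (dd : measure_display) (Y : measurableType dd).
Variables (mu : {measure set Y -> \bar R}) (D : set Y).
Hypotheses (mD : measurable D) (muD : (mu D < +oo)%E).
Variables (T : topologicalType) (i : Y -> T) (K : set T).
Hypotheses (cK : compact K) (DK : forall y, D y -> K (i y)).
Hypothesis mi : forall g : T -> R, continuous g -> measurable_fun D (g \o i).

Lemma continuous_bounded_on_compact (g : T -> R) : continuous g ->
  exists M, forall y, K y -> `|g y| <= M.
Proof.
move=> cg.
have /compact_bounded[M [_ HM]] : compact (g @` K).
  by apply: continuous_compact => //; exact: continuous_subspaceT.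
exists (M + 1) => y Ky; apply: (HM (M + 1)); first by rewrite ltrDl.
by exists y.
Qed.

Lemma continuous_integrable_on (g : T -> R) : continuous g ->
  mu.-integrable D (EFin \o (g \o i)).
Proof.
move=> cg; apply: measurable_bounded_integrable => //; first exact: mi.
have [M HM] := continuous_bounded_on_compact cg.
exists M; split; first exact: num_real.
by move=> r Mr y Dy; apply: le_trans (ltW Mr); exact/HM/DK.
Qed.

Lemma slice_continuous (X : topologicalType) (f : X * T -> R) x :
  continuous f -> continuous (fun y => f (x, y)).
Proof.
move=> cf y; apply: (@continuous_comp _ _ _ (fun y => (x, y)) f); last exact: cf.
by apply: cvg_pair; [exact: cvg_cst|exact: cvg_id].
Qed.

Lemma le_norm_Rintegral_bound (g : T -> R) (M : R) : continuous g ->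
  (forall y, D y -> `|g (i y)| <= M) ->
  `| \int[mu]_(y in D) g (i y) | <= M * fine (mu D).
Proof.
move=> cg gM; have ig := continuous_integrable_on cg.
apply: le_trans (le_normr_Rintegral mD ig) _.
rewrite -Rintegral_cst//; apply: le_Rintegral => //.
- exact: integrable_norm.
- by apply: (@continuous_integrable_on (cst M)) => ?; exact: cvg_cst.
Qed.

Lemma continuous_Rintegral (X : topologicalType) (f : X * T -> R) :
  continuous f -> continuous (fun x => \int[mu]_(y in D) f (x, i y)).
Proof.
move=> cf x0; apply/cvgrPdist_le => /= e e0.
have m0 : 0 < fine (mu D) + 1 by rewrite ltr_wpDl// fine_ge0.
near=> x; rewrite -RintegralB//; try exact: (continuous_integrable_on (slice_continuous cf)).
have /= H := @le_norm_Rintegral_bound (fun y => f (x0, y) - f (x, y)) (e / (fine (mu D) + 1)).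
apply: le_trans (H _ _) _.
- by move=> y; apply: cvgB; exact: slice_continuous.
- move=> y Dy; rewrite distrC ltW//; move: (i y) (DK Dy).
  by near: x; apply: near_compact_uniform => //; rewrite divr_gt0.
by rewrite mulrAC ler_pdivrMr// ler_pM2l// lerDl.
Unshelve. all: by end_near. Qed.

Lemma is_derive_Rintegral (f df : R * T -> R) (a e : R) : 0 < e ->
  (forall (x : R) y, `|x - a| < e ->
    is_derive x 1 (fun x : R => f (x, y)) (df (x, y))) ->
  (forall x, continuous (fun y => f (x, y))) -> continuous df ->
  is_derive a 1 (fun x : R => \int[mu]_(y in D) f (x, i y))
    (\int[mu]_(y in D) df (a, i y)).
Proof.
move=> e0 fdf cf cdf.
have [M HM] := continuous_bounded_on_compact (slice_continuous (x := a) cdf).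
have /nbhs_ballP[r' /= r'0 r'P] := near_compact_uniform a cK cdf ltr01.
pose r := Num.min e r'.
have r0 : 0 < r by rewrite lt_min e0.
have Ie x : `]a - r, a + r[%classic x -> `|x - a| < e.
  rewrite /= in_itv/= -ltr_distl => /lt_le_trans; apply.
  by rewrite ge_min lexx.
have rP x : ball a r x -> forall y, K y -> `|df (x, y) - df (a, y)| < 1.
  by move=> arx; apply: r'P; apply: le_ball arx; rewrite ge_min lexx orbT.
have Ia : `]a - r, a + r[%classic a by rewrite /= in_itv/=; lra.
have bM x y : `]a - r, a + r[%classic x -> D y -> `|df (x, i y)| <= M + 1.
  rewrite /= in_itv/= => /andP[x1 x2] Dy.
  have : `|df (x, i y) - df (a, i y)| < 1.
    by apply: rP; [rewrite /ball/= ltr_distl; lra|exact: DK].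
  have := HM _ (DK Dy).
  have := ler_normD (df (x, i y) - df (a, i y)) (df (a, i y)).
  rewrite subrK; lra.
have M0 : 0 <= `|M| + 1 by rewrite addr_ge0.
have d1E x y : `]a - r, a + r[%classic x ->
    partial1of2 (fun x y => f (x, i y)) x y = df (x, i y).
  by move=> /Ie xa; rewrite partial1of2E; case: (fdf x (i y) xa).
have := @cvg_differentiation_under_integral R _ Y mu (fun x y => f (x, i y)) D mD a (a - r) (a + r) Ia.
move=> H; apply/is_derive1P.
have -> : \int[mu]_(y in D) df (a, i y) = \int[mu]_(y in D) partial1of2 (fun x y => f (x, i y)) a y.
  by apply: eq_Rintegral => y _; rewrite d1E.
apply: (H _ _ (fun _ => `|M| + 1)) => //.
- by move=> x _; exact: (continuous_integrable_on (cf x)).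
- by move=> x y /Ie xa _; case: (fdf x (i y) xa).
- have cM : continuous (cst (`|M| + 1) : T -> R) by move=> ?; exact: cvg_cst.
  exact: (continuous_integrable_on cM).
- move=> x y Ix Dy; rewrite d1E// (le_trans (bM _ _ Ix Dy))// lerD2r.
  exact: ler_norm.
Qed.

End integral_with_parameter.

(** * Affine change of variables for Lebesgue measure *)

Section affine_change_of_variables.
Variable R : realType.
Local Open Scope ereal_scope.

Definition affine (a r : R) (s : measurableTypeR R) : measurableTypeR R :=
  (a + r * s)%R.

Lemma measurable_affine (a r : R) : measurable_fun setT (affine a r).
Proof.
by apply: measurable_funD => //; apply: measurable_funM.
Qed.

HB.instance Definition _ (a r : R) := isMeasurableFun.Build _ _ _ _
  (affine a r) (measurable_affine a r).

Definition affine_pushforward (a r : R) : set (measurableTypeR R) -> \bar R :=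
  pushforward lebesgue_measure (affine a r).

Let affine_pushforward0 a r : affine_pushforward a r set0 = 0.
Proof. exact: measure0. Qed.

Let affine_pushforward_ge0 a r A : 0 <= affine_pushforward a r A.
Proof. exact: measure_ge0. Qed.

Let affine_pushforward_sigma_additive a r :
  semi_sigma_additive (affine_pushforward a r).
Proof. by apply: measure_semi_sigma_additive; exact: measurable_affine. Qed.

HB.instance Definition _ (a r : R) := isMeasure.Build _ _ _
  (affine_pushforward a r) (affine_pushforward0 a r)
  (affine_pushforward_ge0 a r) (@affine_pushforward_sigma_additive a r).

Lemma ge0_integral_affine (F : measurableTypeR R -> \bar R) (a r : R) : (0 < r)%R ->
  measurable_fun setT F -> (forall x, 0 <= F x) ->
  \int[lebesgue_measure]_x F x =
  r%:E * \int[lebesgue_measure]_s F (a + r * s)%R.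
Proof.
move=> r0 mF F0.
have r0' : (0 <= r)%R by exact: ltW.
(* Lebesgue measure is determined by its values on half-open intervals. *)
pose nu := mscale (NngNum r0') (affine_pushforward a r).
have nuE A : measurable A -> lebesgue_measure A = nu A.
  apply: lebesgue_measure_unique => _ [[u v] /= _ <-].
  rewrite /nu /mscale/= /affine_pushforward /pushforward/=.
  have -> : affine a r @^-1` `]u, v] = [set` `]((u - a) / r)%R, ((v - a) / r)%R]%R].
    apply/seteqP; split => s /=; rewrite !in_itv/= => /andP[us sv]; apply/andP.
      by rewrite ltr_pdivrMr// ler_pdivlMr// /affine in us sv *; split; lra.
    move: us sv; rewrite ltr_pdivrMr// ler_pdivlMr// /affine => us sv; split; lra.
  rewrite !lebesgue_measure_itv/= !lte_fin ltr_pM2r ?invr_gt0// ltrD2r.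
  case: ifPn => // _; last by rewrite mule0.
  by rewrite -!EFinD -EFinM; congr (_ %:E); field; rewrite gt_eqF.
transitivity (\int[nu]_x F x).
  by apply: eq_measure_integral => A mA _; exact: nuE.
rewrite ge0_integral_mscale//=; congr (_ * _).
by rewrite /affine_pushforward ge0_integral_pushforward//; exact: measurable_affine.
Qed.

Variable n : nat.

Lemma ge0_integral_rVS (F : 'rV[R]_n.+1 -> \bar R) :
  measurable_fun setT F -> (forall x, 0 <= F x) ->
  \int[lebesgue_rV R n.+1]_x F x =
  \int[lebesgue_measure]_a \int[lebesgue_rV R n]_z F (cons_rV (a, z)).
Proof.
move=> mF F0.
rewrite -(fubini_tonelli1 (F \o @cons_rV R n)) => [|| p]; last exact: F0.
- by rewrite /= /cons_measure ge0_integral_pushforward.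
- by apply: measurableT_comp => //; exact: measurable_cons_rV.
Qed.

Lemma integrable_rVS (F : 'rV[R]_n.+1 -> \bar R) :
  (lebesgue_rV R n.+1).-integrable setT F ->
  (lebesgue_measure \x lebesgue_rV R n).-integrable setT (F \o @cons_rV R n).
Proof.
move=> /integrableP[mF Foo]; apply/integrableP; split.
  by apply: measurableT_comp => //; exact: measurable_cons_rV.
move: Foo; rewrite /= /cons_measure ge0_integral_pushforward//.
exact: measurableT_comp.
Qed.

Lemma integral_rVS (F : 'rV[R]_n.+1 -> \bar R) :
  (lebesgue_rV R n.+1).-integrable setT F ->
  \int[lebesgue_rV R n.+1]_x F x =
  \int[lebesgue_measure \x lebesgue_rV R n]_p F (cons_rV p).
Proof.
move=> iF; rewrite /= /cons_measure integral_pushforward//; last exact: integrable_rVS.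
exact: (measurable_int _ iF).
Qed.

End affine_change_of_variables.

Section change_of_variables_rV.
Variable R : realType.
Local Open Scope ereal_scope.

Lemma cons_rV_affine n (a b r : R) (x z : 'rV[R]_n) :
  (cons_rV (a, x) + r *: cons_rV (b, z))%R = cons_rV ((a + r * b)%R : measurableTypeR R, (x + r *: z)%R).
Proof.
apply/rowP => j; rewrite mxE [X in (_ + X)%R]mxE.
have [k ->|->] := unliftP ord0 j; first by rewrite !cons_rV_lift !mxE.
by rewrite !cons_rV0.
Qed.

Lemma continuous_affine_rV n (r : R) (x : 'rV[R]_n) : continuous (fun z : 'rV[R]_n => x + r *: z)%R.
Proof.
apply: continuous_add; first exact: cst_continuous.
exact: scaler_continuous.
Qed.

Lemma measurable_affine_rV n (r : R) (x : 'rV[R]_n) :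
  measurable_fun setT (fun z : 'rV[R]_n => x + r *: z)%R.
Proof.
apply: measurable_fun_rVP => i; apply: continuous_measurable_rV => z.
apply: (@continuous_comp _ _ _ (fun z : 'rV[R]_n => x + r *: z)%R (@coord_rV R n i)).
  exact: continuous_affine_rV.
exact: coord_continuous.
Qed.

(** By Tonelli the one-dimensional formula is applied to each coordinate in
    turn, which produces the factor [r ^+ n]. *)
Lemma ge0_integral_rV_affine n (F : 'rV[R]_n -> \bar R) (x : 'rV[R]_n) (r : R) :
  (0 < r)%R -> measurable_fun setT F -> (forall x, 0 <= F x) ->
  \int[lebesgue_rV R n]_y F y =
  (r ^+ n)%:E * \int[lebesgue_rV R n]_z F (x + r *: z)%R.
Proof.
move=> r0; elim: n F x => [|n IHn] F x mF F0.
  rewrite expr0 mul1e; apply: eq_integral => z _; congr F.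
  by apply/rowP => -[].
have mFa (G : 'rV[R]_n.+1 -> \bar R) a : measurable_fun setT G ->
    measurable_fun setT (fun z => G (cons_rV (a : measurableTypeR R, z))).
  move=> mG; apply: (measurableT_comp (g := fun z => cons_rV (a : measurableTypeR R, z)) mG).
  apply: (measurableT_comp (@measurable_cons_rV R n)) => //.
have mC : measurable_fun setT (fun z : 'rV[R]_n.+1 => F (x + r *: z)%R).
  by apply: measurableT_comp mF _; exact: measurable_affine_rV.
have mI (G : 'rV[R]_n.+1 -> \bar R) : measurable_fun setT G -> (forall x, 0 <= G x) ->
    measurable_fun setT (fun a : measurableTypeR R => \int[lebesgue_rV R n]_z G (cons_rV (a, z))).
  move=> mG G0.
  have := @measurable_fun_fubini_tonelli_F _ _ (measurableTypeR R) 'rV[R]_n R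
    (lebesgue_rV R n) (G \o @cons_rV R n).
  apply; last by move=> p; exact: G0.
  by apply: measurableT_comp => //; exact: measurable_cons_rV.
have I0 G a : (forall x, 0 <= G x) -> 0 <= \int[lebesgue_rV R n]_z G (cons_rV (a : measurableTypeR R, z)).
  by move=> G0; exact: integral_ge0.
rewrite [LHS]ge0_integral_rVS// [in RHS]ge0_integral_rVS//.
rewrite (@ge0_integral_affine _ _ (x 0 ord0)%R r r0); [|exact: mI|by move=> a; exact: I0].
rewrite exprS EFinM -muleA; congr (_ * _).
rewrite -ge0_integralZl//; last 3 first.
  exact: (mI (fun y => F (x + r *: y)%R)).
  by move=> a _; exact: (I0 (fun y => F (x + r *: y)%R)).
  by rewrite lee_fin exprn_ge0// ltW.
apply: eq_integral => a _.
rewrite (IHn (fun z => F (cons_rV (_, z))) (rsubmx (x : 'rV_(1 + n)))); last 2 first.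
  exact: mFa.
  by move=> z; exact: F0.
congr (_ * _); apply: eq_integral => z _; congr F.
rewrite -cons_rV_affine; congr (_ + _)%R.
apply/rowP => j; have [k ->|->] := unliftP ord0 j; last by rewrite cons_rV0.
by rewrite cons_rV_lift mxE/=; congr (x 0%R _); exact: val_inj.
Qed.

End change_of_variables_rV.

(** * The unit ball and its volume *)

Section unit_ball.
Variable R : realType.

Definition sqnorm n (z : 'rV[R]_n) : R := \sum_(i < n) z 0 i ^+ 2.

Definition unit_ball n : set 'rV[R]_n := [set z | sqnorm z < 1].

Definition unit_cube n : set 'rV[R]_n := [set z | forall i, `[-1, 1]%classic (z 0 i)].

Lemma sqnorm_continuous n : continuous (@sqnorm n).
Proof.
rewrite /sqnorm; apply: continuous_sum => i.
by apply: continuous_exp; exact: coord_continuous.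
Qed.

Lemma sqnorm_cons n (a : measurableTypeR R) (z : 'rV[R]_n) :
  sqnorm (cons_rV (a, z)) = a ^+ 2 + sqnorm z.
Proof.
rewrite /sqnorm big_ord_recl cons_rV0; congr (_ + _).
by apply: eq_bigr => i _; rewrite cons_rV_lift.
Qed.

Lemma sqnorm_ge0 n (z : 'rV[R]_n) : 0 <= sqnorm z.
Proof. by apply: sumr_ge0 => i _; rewrite sqr_ge0. Qed.

Lemma measurable_sqnorm_lt n (c : R) :
  measurable [set z : 'rV[R]_n | sqnorm z < c].
Proof.
have := continuous_measurable_rV (@sqnorm_continuous n).
move=> /(_ measurableT `]-oo, c[%classic (measurable_itv _)).
by rewrite setTI.
Qed.

Lemma measurable_unit_ball n : measurable (@unit_ball n).
Proof. exact: measurable_sqnorm_lt. Qed.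

Lemma unit_ball_cube n : @unit_ball n `<=` @unit_cube n.
Proof.
move=> z z1 i; rewrite /= in_itv/= -ler_norml.
rewrite -(@ler_pXn2r _ 2)// ?nnegrE// expr1n real_normK ?num_real//.
apply: le_trans (ltW z1); rewrite /sqnorm (bigD1 i)//= lerDl.
by apply: sumr_ge0 => j _; rewrite sqr_ge0.
Qed.

Lemma compact_unit_cube n : compact (@unit_cube n).
Proof.
apply: (@rV_compact R n (fun=> `[-1, 1]%classic)) => _.
exact: segment_compact.
Qed.

Lemma measurable_unit_cube n : measurable (@unit_cube n).
Proof.
by apply: (@measurable_box_rV R n (fun=> `[-1, 1]%classic)) => i; exact: measurable_itv.
Qed.

Lemma lebesgue_unit_cube_fin n : (lebesgue_rV R n (@unit_cube n) < +oo)%E.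
Proof.
rewrite (@lebesgue_rV_box R n (fun=> `[-1, 1]%classic)); last first.
  by move=> i; exact: measurable_itv.
have cube1 : (0 <= @lebesgue_measure R `[(-1)%R, 1%R]%classic < +oo)%E.
  by rewrite measure_ge0 lebesgue_measure_itv/= lte_fin ifT ?ltry//; lra.
suff /andP[] : (0 <= \prod_(i < n) @lebesgue_measure R `[(-1)%R, 1%R]%classic < +oo)%E by [].
apply: (big_ind (fun x => 0 <= x < +oo)%E) => // [|x y /andP[x0 xoo] /andP[y0 yoo]].
  by rewrite lee01 ltry.
by rewrite mule_ge0// lte_mul_pinfty// ge0_fin_numE.
Qed.

Lemma lebesgue_unit_ball_fin n : (lebesgue_rV R n (@unit_ball n) < +oo)%E.
Proof.
apply: le_lt_trans (lebesgue_unit_cube_fin n).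
apply: le_measure; rewrite ?inE//; [exact: measurable_unit_ball|
  exact: measurable_unit_cube|exact: unit_ball_cube].
Qed.

Definition ball_volume n : R := fine (lebesgue_rV R n (@unit_ball n)).

Lemma ball_volumeE n : (ball_volume n)%:E = lebesgue_rV R n (@unit_ball n).
Proof.
by rewrite /ball_volume fineK// ge0_fin_numE ?measure_ge0// lebesgue_unit_ball_fin.
Qed.

Let lebesgue_indic n (A : set 'rV[R]_n) : measurable A ->
  lebesgue_rV R n A = (\int[lebesgue_rV R n]_z (\1_A z)%:E)%E.
Proof. by move=> mA; rewrite integral_indic// setIT. Qed.

Lemma lebesgue_ball_radius n (b : R) : 0 < b ->
  lebesgue_rV R n [set z | sqnorm z < b ^+ 2] = (b ^+ n * ball_volume n)%:E.
Proof.
move=> b0; have mS := @measurable_sqnorm_lt n (b ^+ 2).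
rewrite [LHS]lebesgue_indic// (@ge0_integral_rV_affine _ _ _ 0 b)//; last 1 first.
  by apply/measurable_EFinP; exact: measurable_indic.
rewrite EFinM ball_volumeE; congr (_ * _)%E.
rewrite [RHS]lebesgue_indic; last exact: measurable_unit_ball.
apply: eq_integral => z _; rewrite !indicE; congr ((_ : bool)%:R%:E).
apply/idP/idP; rewrite !inE /= add0r /unit_ball /= /sqnorm.
  under eq_bigr do rewrite mxE exprMn.
  by rewrite -mulr_sumr gtr_pMr// exprn_gt0.
under [in X in _ -> X]eq_bigr do rewrite mxE exprMn.
by rewrite -mulr_sumr gtr_pMr// exprn_gt0.
Qed.

Definition wallis n : R :=
  \int[lebesgue_measure]_(a in `[-1, 1]) (Num.sqrt (1 - a ^+ 2)) ^+ n.

Lemma wallis_continuous n : continuous (fun a : R => Num.sqrt (1 - a ^+ 2) ^+ n).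
Proof.
apply: continuous_exp.
apply: (@continuous_compose _ _ _ (fun a : R => 1 - a ^+ 2)); last exact: sqrt_continuous.
apply: continuous_sub; first exact: cst_continuous.
exact: exprn_continuous.
Qed.

(** The slice of the unit ball at first coordinate [a] is a ball of radius
    [Num.sqrt (1 - a ^+ 2)]. *)
Lemma ball_volumeS n : ball_volume n.+1 = ball_volume n * wallis n.
Proof.
apply: EFin_inj; rewrite ball_volumeE.
rewrite lebesgue_indic; last exact: measurable_unit_ball.
rewrite ge0_integral_rVS; [|apply/measurable_EFinP|by move=> x; rewrite lee_fin]; last first.
  by apply: measurable_indic; exact: measurable_unit_ball.
have wc := @wallis_continuous n.
have iwc : lebesgue_measure.-integrable `[(-1)%R, 1%R]%classic
    (EFin \o (fun a : R => Num.sqrt (1 - a ^+ 2) ^+ n)).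
  apply: continuous_compact_integrable; first exact: segment_compact.
  exact: continuous_subspaceT.
have iw : lebesgue_measure.-integrable `](-1)%R, 1%R[%classic
    (EFin \o (fun a : R => Num.sqrt (1 - a ^+ 2) ^+ n)).
  by apply: (integrableS _ _ _ iwc) => //; exact: subset_itv_oo_cc.
transitivity (\int[lebesgue_measure]_(a in `](-1)%R, 1%R[)
    (ball_volume n * Num.sqrt (1 - a ^+ 2) ^+ n)%:E)%E; last first.
  rewrite /wallis EFinM.
  under eq_integral do rewrite EFinM.
  rewrite integralZl//; congr (_ * _)%E.
  rewrite -(@integral_itv_bndoo _ _ _ _ true false)//; last first.
    exact: (measurable_int _ iw).
  by rewrite fineK// integrable_fin_num.
rewrite [RHS]integral_mkcond/=; apply: eq_integral => a _.
transitivity (lebesgue_rV R n [set z | sqnorm z < 1 - a ^+ 2]).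
  rewrite [RHS]lebesgue_indic; last exact: measurable_sqnorm_lt.
  apply: eq_integral => z _; rewrite !indicE; congr ((_ : bool)%:R%:E).
  by apply/idP/idP; rewrite !inE /unit_ball/= sqnorm_cons ltrBrDl.
rewrite /patch; case: ifPn => [|].
  rewrite inE/= in_itv/= => /andP[a1 a2].
  have a0 : 0 < 1 - a ^+ 2 by nra.
  rewrite -{1}[1 - a ^+ 2]sqr_sqrtr ?ltW// lebesgue_ball_radius ?sqrtr_gt0//.
  by rewrite mulrC.
rewrite notin_setE/= in_itv/= => /negP; rewrite negb_and -!leNgt => aa.
have a0 : 1 - a ^+ 2 <= 0 by case/orP: aa => aa; nra.
rewrite (_ : mkset _ = set0) ?measure0//.
apply/seteqP; split => // z /=; have := sqnorm_ge0 z; lra.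
Qed.

End unit_ball.

Section odd_ball_volume.
Variable R : realType.

Lemma Rintegral_derivative (F f : R -> R) (a b : R) : a <= b ->
  (forall x : R, is_derive x 1 F (f x)) -> continuous f ->
  \int[lebesgue_measure]_(x in `[a, b]) f x = F b - F a.
Proof.
rewrite le_eqVlt => /predU1P[<-|ab] dF cf.
  by rewrite set_itv1 Rintegral_set1 subrr.
rewrite /Rintegral (@continuous_FTC2 R f F)//; first exact: continuous_subspaceT.
- have cF : continuous F.
    move=> x; apply: differentiable_continuous.
    by apply/derivable1_diffP; case: (dF x).
  split; first by move=> x _; case: (dF x).
    exact/cvg_at_right_filter/cF.
  exact/cvg_at_left_filter/cF.
- by move=> x _; rewrite derive1E; case: (dF x).
Qed.

Definition cos_integral n : R :=
  \int[lebesgue_measure]_(t in `[- (pi / 2), pi / 2]) cos t ^+ n.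

Lemma cos_integral0 : cos_integral 0 = pi.
Proof.
rewrite /cos_integral.
under eq_Rintegral do rewrite expr0.
rewrite (@Rintegral_derivative id)//; first by rewrite opprK -splitr.
- by have := pi_ge0 R; lra.
- exact: cst_continuous.
Qed.

Lemma cos_integral1 : cos_integral 1 = 2.
Proof.
rewrite /cos_integral.
under eq_Rintegral do rewrite expr1.
rewrite (@Rintegral_derivative sin)//.
- by rewrite sinN sin_pihalf; ring.
- by have := pi_ge0 R; lra.
- exact: continuous_cos.
Qed.

Let cos_exp_continuous n : continuous (fun t : R => cos t ^+ n).
Proof. by apply: continuous_exp; exact: continuous_cos. Qed.

Let continuous_itv_integrable (f : R -> R) (a b : R) : continuous f ->
  lebesgue_measure.-integrable `[a, b] (EFin \o f).
Proof.
move=> cf; apply: continuous_compact_integrable; first exact: segment_compact.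
exact: continuous_subspaceT.
Qed.

(** The classical reduction formula: integrate the derivative of
    [sin t * cos t ^+ n.+1], which vanishes at both ends. *)
Lemma cos_integralSS n :
  n.+2%:R * cos_integral n.+2 = n.+1%:R * cos_integral n.
Proof.
have pi0 := pi_ge0 R.
apply/eqP; rewrite -subr_eq0 -!RintegralZl//; [|exact: continuous_itv_integrable..].
apply/eqP.
rewrite -RintegralB//; last 2 first.
  by apply: continuous_itv_integrable; apply: continuous_mul => //; exact: cst_continuous.
  by apply: continuous_itv_integrable; apply: continuous_mul => //; exact: cst_continuous.
have dF (t : R) : is_derive t 1 (fun t => sin t * cos t ^+ n.+1)
    (n.+2%:R * cos t ^+ n.+2 - n.+1%:R * cos t ^+ n).
  apply: (is_derive_eq (is_derive_mulf (is_derive_sin t)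
    (is_derive_expf n.+1 (is_derive_cos t)))).
  have s2 : sin t ^+ 2 = 1 - cos t ^+ 2 by rewrite -(cos2Dsin2 t); ring.
  rewrite (_ : sin t * _ = - (n.+1%:R * cos t ^+ n * sin t ^+ 2)); last by rewrite /=; ring.
  by rewrite s2 !exprS -!natr1; ring.
rewrite (@Rintegral_derivative _ _ _ _ _ dF)//.
- by rewrite cosN cos_pihalf expr0n/= !mulr0 subrr.
- lra.
- by apply: continuous_sub; apply: continuous_mul => //; exact: cst_continuous.
Qed.

(** By [cos_integralSS] the left-hand side does not depend on [n]. *)
Lemma cos_integralM n :
  n.+1%:R * cos_integral n * cos_integral n.+1 = 2 * pi.
Proof.
elim: n => [|n IHn].
  by rewrite cos_integral0 cos_integral1; ring.
by rewrite -IHn mulrAC cos_integralSS; ring.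
Qed.

(** Substitute [a = sin t]. *)
Lemma wallisE n : wallis R n = cos_integral n.+1.
Proof.
have pi0 := pi_gt0 R.
rewrite /wallis /Rintegral.
have -> : `[(-1)%R, 1%R]%classic = `[sin (- (pi / 2)), sin (pi / 2) : R]%classic.
  by rewrite sinN sin_pihalf.
have dsin : derive1 (@sin R) = cos by apply/funext => x; rewrite derive1E derive_val.
rewrite (@integration_by_substitution_increasing R sin).
- congr fine; apply: eq_integral => t; rewrite inE/= in_itv/= => tpi.
  rewrite dsin exprSr; congr ((_ ^+ n * _)%:E).
  rewrite (_ : 1 - sin t ^+ 2 = cos t ^+ 2); last by rewrite -(cos2Dsin2 t); ring.
  by rewrite sqrtr_sqr ger0_norm// cos_ge0_pihalf.
- lra.
- by move=> x y xpi ypi xy; rewrite ltr_sin.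
- by rewrite dsin => x _; exact: continuous_cos.
- by rewrite dsin; apply/cvg_ex; eexists; apply/cvg_at_right_filter/continuous_cos.
- by rewrite dsin; apply/cvg_ex; eexists; apply/cvg_at_left_filter/continuous_cos.
- split; first by move=> x _; exact: derivable_sin.
    exact/cvg_at_right_filter/continuous_sin.
  exact/cvg_at_left_filter/continuous_sin.
- exact/continuous_subspaceT/wallis_continuous.
Qed.

Lemma ball_volume0 : ball_volume R 0 = 1.
Proof.
rewrite /ball_volume.
have -> : lebesgue_rV R 0 (@unit_ball R 0) = dirac (0 : 'rV[R]_0) (@unit_ball R 0) by [].
rewrite diracE mem_set//.
by rewrite /unit_ball /sqnorm /= big_ord0.
Qed.

(** Slicing twice brings in the product of two consecutive cosine integrals,
    whose value is free of parity; hence the volume recursion steps by two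
    dimensions, and odd dimensions start from the segment. *)
Lemma ball_volumeSS n : n.+2%:R * ball_volume R n.+2 = 2 * pi * ball_volume R n.
Proof. by rewrite !ball_volumeS !wallisE -(cos_integralM n.+1); ring. Qed.

Lemma odd_ball_volume m :
  (\prod_(k < m.+1) (2 * k + 1)%:R) * ball_volume R (2 * m + 1) = 2 ^+ m.+1 * pi ^+ m.
Proof.
elim: m => [|m IHm].
  rewrite big_ord_recl big_ord0 ball_volumeS ball_volume0 wallisE cos_integral1.
  by rewrite /=; ring.
rewrite big_ord_recr/= -mulrA.
have -> : (2 * m.+1 + 1 = (2 * m + 1).+2)%N by rewrite mulnS; ring.
by rewrite ball_volumeSS mulrCA IHm !exprS; ring.
Qed.

End odd_ball_volume.

(** * Integration by parts on the unit ball *)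

Section divergence_on_ball.
Variable R : realType.

Definition set_coord n (i : 'I_n) (z : 'rV[R]_n) (s : R) : 'rV[R]_n :=
  \row_j (if j == i then s else z 0 j).

Lemma set_coord_cons0 n (a s : measurableTypeR R) (z : 'rV[R]_n) :
  set_coord ord0 (cons_rV (a, z)) s = cons_rV (s, z).
Proof.
apply/rowP => j; rewrite mxE; have [k ->|->] := unliftP ord0 j.
  by rewrite eq_sym (negbTE (neq_lift _ _)) !cons_rV_lift.
by rewrite eqxx cons_rV0.
Qed.

Lemma set_coord_cons_lift n (i : 'I_n) (a s : measurableTypeR R) (z : 'rV[R]_n) :
  set_coord (lift ord0 i) (cons_rV (a, z)) s = cons_rV (a, set_coord i z s).
Proof.
apply/rowP => j; rewrite mxE; have [k ->|->] := unliftP ord0 j.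
  by rewrite (inj_eq lift_inj) !cons_rV_lift mxE.
by rewrite (negbTE (neq_lift _ _)) !cons_rV0.
Qed.

(** Fubini in an arbitrary coordinate direction. Lebesgue measure on row vectors
    is built by splitting off the first coordinate, so the direction [i] is
    reached by induction on the dimension. Boundedness and bounded support are
    inherited by all sections, which keeps every inner integral meaningful. *)
Lemma integral_lines0 n (i : 'I_n) (G : 'rV[R]_n -> R) (M : R) :
  measurable_fun setT G -> (forall z, `|G z| <= M) ->
  (forall z, ~ unit_cube z -> G z = 0) ->
  (forall z, \int[lebesgue_measure]_s (G (set_coord i z s))%:E = 0)%E ->
  (\int[lebesgue_rV R n]_z (G z)%:E = 0)%E.
Proof.
elim: n i G => [[]//|n IHn] i G mG GM G0 GI.
have iG : (lebesgue_rV R n.+1).-integrable setT (EFin \o G).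
  have -> : EFin \o G = (EFin \o G) \_ (@unit_cube R n.+1).
    apply/funext => z; rewrite patchE; case: ifPn => //.
    by rewrite notin_setE => /G0 /= ->.
  apply/(integrable_mkcond _ (@measurable_unit_cube R n.+1)).
  apply: measurable_bounded_integrable.
  - exact: measurable_unit_cube.
  - exact: lebesgue_unit_cube_fin.
  - exact: measurable_funTS.
  - exists M; split; first exact: num_real.
    by move=> r Mr y _; apply: le_trans (ltW Mr); exact: GM.
rewrite integral_rVS//.
have [j ei|ei] := unliftP ord0 i; last first.
  rewrite -integral21_prod_meas1; last exact: (integrable_rVS iG).
  apply: integral0_eq => z _; rewrite /fubini_G/= -[RHS](GI (cons_rV (0 : measurableTypeR R, z))).
  by apply: eq_integral => s _; rewrite ei set_coord_cons0.
rewrite -integral12_prod_meas1; last exact: (integrable_rVS iG).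
apply: integral0_eq => a _; rewrite /fubini_F/=.
apply: (IHn j (fun z => G (cons_rV (a : measurableTypeR R, z)))).
- apply: (measurableT_comp (g := fun z => cons_rV (a : measurableTypeR R, z)) mG).
  by apply: (measurableT_comp (@measurable_cons_rV R n)).
- by move=> z; exact: GM.
- move=> z nz; apply: G0 => cz; apply: nz => k.
  by have := cz (lift ord0 k); rewrite cons_rV_lift.
- move=> z; rewrite -[RHS](GI (cons_rV (a : measurableTypeR R, z))).
  by apply: eq_integral => s _; rewrite ei set_coord_cons_lift.
Qed.

Lemma set_coord_line n (i : 'I_n) (z : 'rV[R]_n) s :
  set_coord i z s = set_coord i z 0 + s *: delta_mx 0 i.
Proof.
apply/rowP => j; rewrite !mxE eqxx/=; case: eqP => _; first by rewrite mulr1 add0r.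
by rewrite mulr0 addr0.
Qed.

Lemma sqnorm_set_coord n (i : 'I_n) (z : 'rV[R]_n) s :
  sqnorm (set_coord i z s) = sqnorm (set_coord i z 0) + s ^+ 2.
Proof.
rewrite /sqnorm (bigD1 i)//= [in RHS](bigD1 i)//= !mxE eqxx expr0n add0r addrC.
congr (_ + _); apply: eq_bigr => j ji; by rewrite !mxE (negbTE ji).
Qed.

(** The integrand is the [i]-th partial derivative of [(1 - sqnorm z) * h z],
    which vanishes on the unit sphere: its integral along each chord parallel to
    the [i]-th axis is zero. The weight [1 - sqnorm z] replaces boundary terms,
    so that surface integrals never appear. *)
Lemma ball_divergence n (i : 'I_n) (h dh : 'rV[R]_n -> R) :
  continuous h -> continuous dh ->
  (forall z, is_derive z (delta_mx 0 i : 'rV[R]_n) h (dh z)) ->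
  \int[lebesgue_rV R n]_(z in @unit_ball R n)
    ((1 - sqnorm z) * dh z - 2 * z 0 i * h z) = 0.
Proof.
move=> ch cdh hdh.
pose g z := (1 - sqnorm z) * dh z - 2 * z 0 i * h z.
have cg : continuous g.
  apply: continuous_sub.
    apply: continuous_mul => //; apply: continuous_sub; first exact: cst_continuous.
    exact: sqnorm_continuous.
  apply: continuous_mul => //.
  by apply: continuous_mul; [exact: cst_continuous|exact: coord_continuous].
rewrite /Rintegral integral_mkcond/=.
rewrite (_ : _ \_ _ = EFin \o (g \_ (@unit_ball R n))); last first.
  by apply/funext => z; rewrite /= !patchE; case: ifP.
have [M HM] := continuous_bounded_on_compact (@compact_unit_cube R n) cg.
have M0 : 0 <= M by apply: le_trans (HM 0 _) => // j; rewrite mxE/= in_itv/=; lra.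
rewrite (@integral_lines0 n i _ M)//.
- apply/(measurable_restrictT _ _).1; first exact: measurable_unit_ball.
  exact: (measurable_funTS (continuous_measurable_rV cg)).
- move=> z; rewrite patchE; case: ifPn => [|_]; last by rewrite normr0.
  by rewrite inE => zB; apply/HM/unit_ball_cube.
- move=> z zC; rewrite patchE memNset// => zB; exact/zC/unit_ball_cube.
move=> z; set y := set_coord i z 0.
pose c := sqnorm y.
have [c1|c1] := leP 1 c.
  apply: integral0_eq => s _; rewrite patchE memNset// /unit_ball/= sqnorm_set_coord -/y -/c.
  by have := sqr_ge0 s; lra.
(* The line through [y] in direction [i] meets the ball where [|s| < b]. *)
pose b := Num.sqrt (1 - c).
have b0 : 0 < b by rewrite sqrtr_gt0; lra.
have b2 : b ^+ 2 = 1 - c by rewrite sqr_sqrtr//; lra.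
pose e := (delta_mx 0 i : 'rV[R]_n).
pose k s := (b ^+ 2 - s ^+ 2) * dh (y + s *: e) - 2 * s * h (y + s *: e).
have cline : continuous (fun s : R => y + s *: e).
  apply: continuous_add; first exact: cst_continuous.
  exact: scalel_continuous.
have ck : continuous k.
  apply: continuous_sub.
    apply: continuous_mul; last exact: (continuous_compose cline cdh).
    apply: continuous_sub; first exact: cst_continuous.
    exact: exprn_continuous.
  apply: continuous_mul.
    apply: continuous_mul; [exact: cst_continuous|move=> s; exact: cvg_id].
  exact: (continuous_compose cline ch).
transitivity (\int[lebesgue_measure]_(s in `](- b)%R, b%R[) (k s)%:E)%E.
  rewrite [RHS]integral_mkcond/=; apply: eq_integral => s _.
  rewrite !patchE.
  have -> : (set_coord i z s \in @unit_ball R n) = (s \in `]- b, b[%classic).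
    apply/idP/idP; rewrite !inE /unit_ball/= sqnorm_set_coord -/y -/c in_itv/=.
      move=> s1; have s2 : s ^+ 2 < b ^+ 2 by rewrite b2; lra.
      by rewrite -ltr_norml -(@ltr_pXn2r _ 2)// ?nnegrE ?(ltW b0)// real_normK ?num_real.
    rewrite -ltr_norml => sb.
    suff : s ^+ 2 < b ^+ 2 by rewrite b2; lra.
    by rewrite -(real_normK (num_real s)) ltr_pXn2r// ?nnegrE// ltW.
  case: ifPn => // _; congr (_%:E); rewrite /g /k sqnorm_set_coord -/y -/c b2.
  rewrite mxE eqxx -set_coord_line; congr (_ * _ - _); ring.
rewrite -(@integral_itv_bndoo _ _ _ _ true false); last first.
  apply/measurable_EFinP; apply: measurable_funTS.
  exact: continuous_measurable_fun.
have dk (s : R) : is_derive s 1 (fun s => (b ^+ 2 - s ^+ 2) * h (y + s *: e)) (k s).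
  have d1 : is_derive s 1 (fun s : R => b ^+ 2 - s ^+ 2) (- (2 * s)).
    have := is_derive_addf (is_derive_cst (b ^+ 2) s 1)
      (is_derive_mulcf (- 1) (is_derive_expf 2 (is_derive_id s 1))).
    rewrite /=; under eq_fun do rewrite mulN1r.
    by move=> H; apply: (is_derive_eq H); rewrite /=; ring.
  have d2 : is_derive s 1 (fun s : R => h (y + s *: e)) (dh (y + s *: e)).
    exact: ((is_derive_line h y e s _).1 (hdh (y + s *: e))).
  by apply: (is_derive_eq (is_derive_mulf d1 d2)); rewrite /k; ring.
have bb : - b <= b by lra.
have := @Rintegral_derivative R _ _ _ _ bb dk ck.
rewrite sqrrN !subrr !mul0r subrr /Rintegral => I0.
rewrite -[LHS]fineK ?I0//.
apply: integrable_fin_num => //.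
apply: continuous_compact_integrable; first exact: segment_compact.
exact: continuous_subspaceT.
Qed.

End divergence_on_ball.

(** * Functions with continuous spatial derivatives *)

Section spatial_regularity.
Variables (R : realType) (d : nat).
Local Notation V := 'rV[R]_d.
Local Notation ee i := (delta_mx 0 i : V).

Definition partial (P : Type) (i : 'I_d) (f : V -> P -> R) (x : V) (p : P) : R :=
  'D_(ee i) (f ^~ p) x.

(** Only the spatial variable is differentiated; [P] collects the parameters,
    namely time for the source, and radius and time for its ball averages. *)
Fixpoint space_C (P : topologicalType) (n : nat) (f : V -> P -> R) : Prop :=
  continuous (fun q : V * P => f q.1 q.2) /\
  match n with
  | 0 => True
  | n'.+1 => (forall i x p, derivable (f ^~ p) x (ee i)) /\
             (forall i, space_C n' (partial i f))
  end.

Definition lap (P : Type) (f : V -> P -> R) (x : V) (p : P) : R :=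
  \sum_(i < d) partial i (partial i f) x p.

Section theory.
Variable P : topologicalType.
Implicit Types (f g : V -> P -> R) (n : nat).

Lemma space_C_continuous n f : space_C n f -> continuous (fun q : V * P => f q.1 q.2).
Proof. by case: n => [|n] []. Qed.

Lemma space_CW n f : space_C n.+1 f -> space_C n f.
Proof.
elim: n f => [|n IHn] f [cf [df Cf]]; first by split.
by split=> //; split=> // i; exact: (IHn _ (Cf i)).
Qed.

Lemma space_C_le k n f : (k <= n)%N -> space_C n f -> space_C k f.
Proof.
move=> /subnK <-; elim: (n - k)%N => // l IHl; rewrite addSn => /space_CW.
exact: IHl.
Qed.

Lemma space_C_partial n i f : space_C n.+1 f -> space_C n (partial i f).
Proof. by case=> _ [_]; exact. Qed.

Lemma space_C_is_derive n f i x p : space_C n.+1 f ->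
  is_derive x (ee i) (f ^~ p) (partial i f x p).
Proof. by case=> _ [df _]; split => //; exact: df. Qed.

Lemma partial_uniq f i (df : V -> P -> R) :
  (forall x p, is_derive x (ee i) (f ^~ p) (df x p)) -> partial i f = df.
Proof. by move=> fdf; apply/funext => x; apply/funext => p; case: (fdf x p). Qed.

Lemma space_C_intro n f (df : 'I_d -> V -> P -> R) :
  continuous (fun q : V * P => f q.1 q.2) ->
  (forall i x p, is_derive x (ee i) (f ^~ p) (df i x p)) ->
  (forall i, space_C n (df i)) -> space_C n.+1 f.
Proof.
move=> cf fdf Cdf; split=> //; split; first by move=> i x p; case: (fdf i x p).
by move=> i; rewrite (partial_uniq (fdf i)).
Qed.

Lemma partialD n f g i : space_C n.+1 f -> space_C n.+1 g ->
  partial i (fun x p => f x p + g x p) = (fun x p => partial i f x p + partial i g x p).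
Proof.
move=> Cf Cg; apply: partial_uniq => x p.
by apply: is_derive_addf; [exact: (space_C_is_derive i x p Cf)|
  exact: (space_C_is_derive i x p Cg)].
Qed.

Lemma partialZ n (c : P -> R) f i : space_C n.+1 f ->
  partial i (fun x p => c p * f x p) = (fun x p => c p * partial i f x p).
Proof.
move=> Cf; apply: partial_uniq => x p.
by apply: is_derive_mulcf; exact: (space_C_is_derive i x p Cf).
Qed.

Lemma space_CD n f g : space_C n f -> space_C n g ->
  space_C n (fun x p => f x p + g x p).
Proof.
elim: n f g => [|n IHn] f g Cf Cg.
  by split=> //; apply: continuous_add; [case: Cf|case: Cg].
apply: (@space_C_intro n _ (fun i x p => partial i f x p + partial i g x p)).
- by apply: continuous_add; [case: Cf|case: Cg].
- by move=> i x p; apply: is_derive_addf; [exact: (space_C_is_derive i x p Cf)|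
  exact: (space_C_is_derive i x p Cg)].
- by move=> i; apply: IHn; exact: space_C_partial.
Qed.

Lemma space_CZ n (c : P -> R) f : continuous c -> space_C n f ->
  space_C n (fun x p => c p * f x p).
Proof.
move=> cc.
have cc2 : continuous (fun q : V * P => c q.2).
  by apply: continuous_compose cc; exact: snd_continuous.
elim: n f => [|n IHn] f Cf.
  by split=> //; apply: continuous_mul => //; case: Cf.
apply: (@space_C_intro n _ (fun i x p => c p * partial i f x p)).
- by apply: continuous_mul => //; case: Cf.
- by move=> i x p; apply: is_derive_mulcf; exact: (space_C_is_derive i x p Cf).
- by move=> i; apply: IHn; exact: space_C_partial.
Qed.

Lemma space_C0 n : space_C n (fun (_ : V) (_ : P) => 0 : R).
Proof.
elim: n => [|n IHn]; first by split=> //; exact: cst_continuous.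
apply: (@space_C_intro n _ (fun _ _ _ => 0)) => //; first exact: cst_continuous.
by move=> i x p; exact: is_derive_cst.
Qed.

Lemma space_C_sum n (I : Type) (r : seq I) (f : I -> V -> P -> R) :
  (forall i, space_C n (f i)) -> space_C n (fun x p => \sum_(i <- r) f i x p).
Proof.
move=> Cf; elim: r => [|i r IHr].
  rewrite (_ : (fun x p => _) = fun _ _ => 0); first exact: space_C0.
  by apply/funext => x; apply/funext => p; rewrite big_nil.
rewrite (_ : (fun x p => _) = fun x p => f i x p + \sum_(j <- r) f j x p).
  exact: space_CD.
by apply/funext => x; apply/funext => p; rewrite big_cons.
Qed.

Lemma space_C_lap n f : space_C n.+2 f -> space_C n (lap f).
Proof.
by move=> Cf; apply: space_C_sum => i; do 2 apply: space_C_partial.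
Qed.

Lemma lapD f g : space_C 2 f -> space_C 2 g ->
  lap (fun x p => f x p + g x p) = (fun x p => lap f x p + lap g x p).
Proof.
move=> Cf Cg; apply/funext => x; apply/funext => p; rewrite /lap -big_split/=.
apply: eq_bigr => i _.
by rewrite (partialD i Cf Cg) (partialD (n := 0) i)//; exact: space_C_partial.
Qed.

Lemma lapZ (c : P -> R) f : space_C 2 f ->
  lap (fun x p => c p * f x p) = (fun x p => c p * lap f x p).
Proof.
move=> Cf; apply/funext => x; apply/funext => p; rewrite /lap mulr_sumr.
apply: eq_bigr => i _.
by rewrite (partialZ c i Cf) (partialZ (n := 0) c i)//; exact: space_C_partial.
Qed.

(** Continuous partial derivatives suffice for the chain rule: the coordinates of
    [z] are added one by one, each step being [is_derive_diagonal]. *)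
Lemma is_derive_chain f (x z : V) (r : R) p : space_C 1 f ->
  is_derive r 1 (fun r => f (x + r *: z) p)
    (\sum_(i < d) z 0 i * partial i f (x + r *: z) p).
Proof.
move=> Cf.
have sumE (s : seq 'I_d) : forall x, is_derive r 1
    (fun r => f (x + r *: \sum_(i <- s) z 0 i *: ee i) p)
    (\sum_(i <- s) z 0 i * partial i f (x + r *: \sum_(i <- s) z 0 i *: ee i) p).
  elim: s => [|j s IHs] {}x.
    under eq_fun do rewrite big_nil scaler0 addr0.
    by rewrite big_nil; exact: is_derive_cst.
  rewrite !big_cons.
  pose v := \sum_(i <- s) z 0 i *: ee i.
  pose q (ab : R * R) := z 0 j * partial j f (x + ab.1 *: (z 0 j *: ee j) + ab.2 *: v) p.
  have cq : continuous q.
    apply: continuous_mul; first exact: cst_continuous.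
    apply: (@continuous_compose _ _ _ (fun ab : R * R =>
      (x + ab.1 *: (z 0 j *: ee j) + ab.2 *: v, p)) (fun q => partial j f q.1 q.2)).
      apply: continuous_pair; last exact: cst_continuous.
      apply: continuous_add.
        apply: continuous_add; first exact: cst_continuous.
        apply: continuous_scale; [exact: fst_continuous|exact: cst_continuous].
      apply: continuous_scale; [exact: snd_continuous|exact: cst_continuous].
    by apply: (@space_C_continuous 0); exact: space_C_partial.
  have W1 (a b : R) : `|a - r| < 1 -> is_derive a 1
      (fun a => f (x + a *: (z 0 j *: ee j) + b *: v) p) (q (a, b)).
    move=> _.
    have H := is_derive_line (f^~ p) (x + b *: v) (ee j) (a * z 0 j)
      (partial j f (x + b *: v + (a * z 0 j) *: ee j) p).
    have {}H := H.1 (space_C_is_derive _ _ _ Cf).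
    have da : is_derive a 1 (fun a : R => a * z 0 j) (z 0 j).
      apply: (is_derive_eq (is_derive_mulf (is_derive_id a 1) (is_derive_cst (z 0 j) a 1))).
      by rewrite /=; ring.
    have := @is_derive1_comp _ _ (fun a => a * z 0 j) a _ _ H da.
    rewrite /q /= scalerA mulrC [x + _ + _]addrAC.
    congr (is_derive _ _ _ _).
    by apply/funext => c /=; rewrite scalerA [x + _ + _]addrAC.
  have := @is_derive_diagonal R
    (fun a b => f (x + a *: (z 0 j *: ee j) + b *: v) p) q r 1 _ ltr01 W1 (cq _)
    (IHs (x + r *: (z 0 j *: ee j))).
  rewrite /q /= -addrA -scalerDr; congr (is_derive _ _ _ _).
    by apply/funext => c; rewrite -addrA -scalerDr.
by have := sumE (index_enum _) x; rewrite -row_sum_delta.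
Qed.

End theory.
End spatial_regularity.

(** * Averages over balls *)

Section ball_average.
Variables (R : realType) (d : nat).
Local Notation V := 'rV[R]_d.
Local Notation ee i := (delta_mx 0 i : V).
Local Notation B := (@unit_ball R d).
Local Notation mu := (lebesgue_rV R d).

Implicit Types (chi : V -> R) (f : V -> R -> R) (x : V) (p : R * R).

Let mB := @measurable_unit_ball R d.
Let fB := @lebesgue_unit_ball_fin R d.
Let cK := @compact_unit_cube R d.
Let BK : forall z, B z -> unit_cube z := @unit_ball_cube R d.

Let mcont (g : V -> R) : continuous g -> measurable_fun B (g \o id).
Proof. by move=> cg; exact: (measurable_funTS (continuous_measurable_rV cg)). Qed.

Lemma ball_integrable (g : V -> R) : continuous g -> mu.-integrable B (EFin \o g).
Proof. exact: (continuous_integrable_on mB fB cK BK mcont). Qed.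

(** Integrating over the fixed unit ball, with [p.1] as a dilation factor, makes
    the average a smooth function of the radius across radius zero. *)
Definition ball_avg (chi : V -> R) (f : V -> R -> R) (x : V) (p : R * R) : R :=
  \int[mu]_(z in B) (chi z * f (x + p.1 *: z) p.2).

Let integrand_continuous (T : topologicalType) (chi : V -> R) (f : V -> R -> R)
    (g : T -> V) (a : T -> R) (s : T -> R) (z : T -> V) :
  continuous chi -> continuous (fun q : V * R => f q.1 q.2) ->
  continuous g -> continuous a -> continuous s -> continuous z ->
  continuous (fun t => chi (z t) * f (g t + a t *: z t) (s t)).
Proof.
move=> cchi cf cg ca cs cz; apply: continuous_mul.
  exact: (continuous_compose cz cchi).
apply: (@continuous_compose _ _ _ (fun t => (g t + a t *: z t, s t))
  (fun q => f q.1 q.2)) => //.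
by apply: continuous_pair => //; apply: continuous_add => //; exact: continuous_scale.
Qed.

Let id_continuous (T : topologicalType) : continuous (@id T).
Proof. by move=> x; exact: cvg_id. Qed.

Lemma ball_avg_integrand_continuous chi f x p :
  continuous chi -> continuous (fun q : V * R => f q.1 q.2) ->
  continuous (fun z : V => chi z * f (x + p.1 *: z) p.2).
Proof.
move=> cchi cf; apply: (@integrand_continuous _ _ _ (cst x) (cst p.1) (cst p.2) id) => //;
  solve [exact: cst_continuous|exact: id_continuous].
Qed.

Lemma ball_avg_continuous chi f :
  continuous chi -> continuous (fun q : V * R => f q.1 q.2) ->
  continuous (fun q : V * (R * R) => ball_avg chi f q.1 q.2).
Proof.
move=> cchi cf.
apply: (continuous_Rintegral mB fB cK BK mcont
  (f := fun t : (V * (R * R)) * V =>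
    chi t.2 * f (t.1.1 + t.1.2.1 *: t.2) t.1.2.2)).
have c1 := @fst_continuous (V * (R * R))%type V.
have c12 := continuous_compose c1 (@snd_continuous V (R * R)%type).
apply: integrand_continuous => //.
- exact: (continuous_compose c1 (@fst_continuous V (R * R)%type)).
- exact: (continuous_compose c12 (@fst_continuous R R)).
- exact: (continuous_compose c12 (@snd_continuous R R)).
- exact: snd_continuous.
Qed.

Lemma ball_avg_is_derive chi f i x p : continuous chi -> space_C 1 f ->
  is_derive x (ee i) ((ball_avg chi f)^~ p) (ball_avg chi (partial i f) x p).
Proof.
move=> cchi Cf.
have cf := space_C_continuous Cf.
have cdf := space_C_continuous (space_C_partial i Cf).
have xE : x = x + 0 *: ee i by rewrite scale0r addr0.
rewrite [X in is_derive X _ _ _]xE; apply/is_derive_line.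
rewrite {2}xE.
apply: (is_derive_Rintegral mB fB cK BK mcont ltr01
  (f := fun t : R * V => chi t.2 * f (x + t.1 *: ee i + p.1 *: t.2) p.2)
  (df := fun t : R * V => chi t.2 * partial i f (x + t.1 *: ee i + p.1 *: t.2) p.2)).
- move=> a z _ /=; apply: is_derive_mulcf.
  have := (is_derive_line (f^~ p.2) (x + p.1 *: z) (ee i) a
    (partial i f (x + p.1 *: z + a *: ee i) p.2)).1 (space_C_is_derive i _ _ Cf).
  rewrite [x + _ + _]addrAC; congr (is_derive _ _ _ _).
  by apply/funext => b; rewrite addrAC.
- move=> a; apply: (@integrand_continuous _ _ _ (cst (x + a *: ee i)) (cst p.1) (cst p.2) id) => //;
    solve [exact: cst_continuous|exact: id_continuous].
- have cline : continuous (fun t : R * V => x + t.1 *: ee i).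
    apply: continuous_add; first exact: cst_continuous.
    by apply: continuous_scale; [exact: fst_continuous|exact: cst_continuous].
  exact: (integrand_continuous cchi cdf cline (@cst_continuous _ _ p.1)
    (@cst_continuous _ _ p.2) (@snd_continuous R V)).
Qed.

Lemma partial_ball_avg chi f i : continuous chi -> space_C 1 f ->
  partial i (ball_avg chi f) = ball_avg chi (partial i f).
Proof.
by move=> cchi Cf; apply: partial_uniq => x p; exact: ball_avg_is_derive.
Qed.

Lemma ball_avg_space_C n chi f : continuous chi -> space_C n f ->
  space_C n (ball_avg chi f).
Proof.
move=> cchi; elim: n f => [|n IHn] f Cf.
  by split=> //; apply: ball_avg_continuous => //; exact: (space_C_continuous Cf).
apply: (@space_C_intro _ _ _ _ _ (fun i => ball_avg chi (partial i f))).
- by apply: ball_avg_continuous => //; exact: (space_C_continuous Cf).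
- move=> i x p; apply: ball_avg_is_derive => //; exact: (space_C_le _ Cf).
- by move=> i; apply: IHn; exact: space_C_partial.
Qed.

Lemma lap_ball_avg chi f : continuous chi -> space_C 2 f ->
  lap (ball_avg chi f) = ball_avg chi (lap f).
Proof.
move=> cchi Cf; apply/funext => x; apply/funext => p.
transitivity (\sum_(i < d) ball_avg chi (partial i (partial i f)) x p).
  apply: eq_bigr => i _; rewrite (partial_ball_avg i cchi (space_CW Cf)).
  by rewrite (partial_ball_avg i cchi (space_C_partial i Cf)).
rewrite /ball_avg.
have intg i : continuous (fun z : V =>
    chi z * partial i (partial i f) (x + p.1 *: z) p.2).
  apply: ball_avg_integrand_continuous => //.
  exact: (space_C_continuous (space_C_partial i (space_C_partial i Cf))).
rewrite -Rintegral_sum//; last by move=> i; exact: ball_integrable.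
apply: eq_Rintegral => z _.
by rewrite mulr_sumr.
Qed.

Lemma ball_avg_is_derive_radius chi f x (r s : R) : continuous chi -> space_C 1 f ->
  is_derive r 1 (fun r : R => ball_avg chi f x (r, s))
    (\int[mu]_(z in B) (chi z *
       \sum_(i < d) z 0 i * partial i f (x + r *: z) s)).
Proof.
move=> cchi Cf.
have cf := space_C_continuous Cf.
apply: (is_derive_Rintegral mB fB cK BK mcont ltr01
  (f := fun t : R * V => chi t.2 * f (x + t.1 *: t.2) s)
  (df := fun t : R * V => chi t.2 *
     \sum_(i < d) t.2 0 i * partial i f (x + t.1 *: t.2) s)).
- by move=> a z _ /=; apply: is_derive_mulcf; exact: is_derive_chain.
- move=> a; apply: (@integrand_continuous _ _ _ (cst x) (cst a) (cst s) id) => //;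
    solve [exact: cst_continuous|exact: id_continuous].
- apply: continuous_mul.
    by apply: (continuous_compose (@snd_continuous _ _)).
  apply: continuous_sum => i.
  have cdf := space_C_continuous (space_C_partial i Cf).
  have ci : continuous (fun z : V => z 0 i) by exact: coord_continuous.
  exact: (integrand_continuous ci cdf (@cst_continuous _ _ x) (@fst_continuous R V)
    (@cst_continuous _ _ s) (@snd_continuous R V)).
Qed.

End ball_average.

Section ladder.
Variables (R : realType) (d : nat).
Local Notation V := 'rV[R]_d.
Local Notation B := (@unit_ball R d).
Local Notation mu := (lebesgue_rV R d).
Implicit Types (f : V -> R -> R) (x : V) (p : R * R) (r s : R).

Definition weight (z : V) : R := (1 - sqnorm z) / 2.

Definition ball_mean f : V -> R * R -> R := ball_avg (cst 1) f.
Definition weighted_mean f : V -> R * R -> R := ball_avg weight f.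

Let mB := @measurable_unit_ball R d.

Lemma weight_continuous : continuous weight.
Proof.
apply: continuous_mul; last exact: cst_continuous.
by apply: continuous_sub; [exact: cst_continuous|exact: sqnorm_continuous].
Qed.

Lemma cst1_continuous : continuous (cst 1 : V -> R).
Proof. exact: cst_continuous. Qed.

Let comp_continuous f x r s : continuous (fun q : V * R => f q.1 q.2) ->
  continuous (fun z : V => f (x + r *: z) s).
Proof.
move=> cf; have := ball_avg_integrand_continuous (x := x) (p := (r, s)) cst1_continuous cf.
by rewrite (_ : (fun z => _) = fun z => f (x + r *: z) s)//; apply/funext => z; rewrite mul1r.
Qed.

Let affine_derive f i x r s z : space_C 1 f ->
  is_derive z (delta_mx 0 i : V) (fun z => f (x + r *: z) s)
    (r * partial i f (x + r *: z) s).
Proof.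
move=> Cf; have zE : z = z + 0 *: delta_mx 0 i by rewrite scale0r addr0.
rewrite [X in is_derive X _ _ _]zE.
apply/(is_derive_line (fun z => f (x + r *: z) s)).
have H := (is_derive_line (f ^~ s) (x + r *: z) (delta_mx 0 i) (0 * r)
  (partial i f (x + r *: z + (0 * r) *: delta_mx 0 i) s)).1 (space_C_is_derive i _ _ Cf).
have da : is_derive (0 : R) 1 (fun a : R => a * r) r.
  apply: (is_derive_eq (is_derive_mulf (is_derive_id (0 : R) 1) (is_derive_cst r (0 : R) 1))).
  by rewrite /=; ring.
have := @is_derive1_comp _ _ (fun a => a * r) 0 _ _ H da.
rewrite mul0r scale0r addr0 mulrC; congr (is_derive _ _ _ _).
by apply/funext => a /=; rewrite scalerDr scalerA [a * r]mulrC addrA.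
Qed.

(** The radial derivative of the mean is the mean of [z] against the gradient;
    since [- z] is the gradient of [weight], integrating by parts with
    [ball_divergence] moves one more derivative onto [f]. *)
Lemma ball_mean_is_derive f x r s : space_C 2 f ->
  is_derive r 1 (fun r => ball_mean f x (r, s)) (r * weighted_mean (lap f) x (r, s)).
Proof.
move=> Cf.
have Cf1 := space_CW Cf.
apply: (is_derive_eq (ball_avg_is_derive_radius x r s cst1_continuous Cf1)).
have cdd i : continuous (fun z : V => partial i (partial i f) (x + r *: z) s).
  by apply: comp_continuous; apply: space_C_continuous (space_C_partial i (space_C_partial i Cf)).
have cd i : continuous (fun z : V => partial i f (x + r *: z) s).
  by apply: comp_continuous; apply: space_C_continuous (space_C_partial i Cf).
have cz i : continuous (fun z : V => z 0 i * partial i f (x + r *: z) s).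
  by apply: continuous_mul => //; exact: coord_continuous.
have cw i : continuous (fun z : V => r * (weight z * partial i (partial i f) (x + r *: z) s)).
  apply: continuous_mul; first exact: cst_continuous.
  by apply: continuous_mul => //; exact: weight_continuous.
have clap : continuous (fun z : V => weight z * lap f (x + r *: z) s).
  apply: continuous_mul; first exact: weight_continuous.
  by apply: comp_continuous; exact: space_C_continuous (space_C_lap Cf).
rewrite /weighted_mean /ball_avg -RintegralZl//; last exact: ball_integrable.
transitivity (\sum_(i < d) \int[mu]_(z in B) (z 0 i * partial i f (x + r *: z) s)).
  rewrite -Rintegral_sum//; last by move=> i; exact: ball_integrable.
  apply: eq_Rintegral => z _; rewrite mul1r//.
transitivity (\sum_(i < d) \int[mu]_(z in B)
    (r * (weight z * partial i (partial i f) (x + r *: z) s))); last first.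
  rewrite -Rintegral_sum//; last by move=> i; exact: ball_integrable.
  apply: eq_Rintegral => z _ /=.
  by rewrite /lap mulr_sumr mulr_sumr.
apply: eq_bigr => i _; apply/eqP; rewrite eq_sym -subr_eq0; apply/eqP.
rewrite -RintegralB//; [|exact: ball_integrable..].
have cdd' : continuous (fun z : V => r * partial i (partial i f) (x + r *: z) s).
  by apply: continuous_mul => //; exact: cst_continuous.
have := ball_divergence (cd i) cdd' (fun z => affine_derive i x r s z (space_C_partial i Cf)).
rewrite (_ : \int[mu]_(z in _) _ =
   \int[mu]_(z in B) (2 * (r * (weight z * partial i (partial i f) (x + r *: z) s)
      - z 0 i * partial i f (x + r *: z) s))); last first.
  by apply: eq_Rintegral => z _; rewrite /weight; field.
rewrite RintegralZl//; last by apply: ball_integrable; exact: continuous_sub.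
by move/eqP; rewrite mulf_eq0 pnatr_eq0/= => /eqP.
Qed.

(** The divergence of [weight z *: z] times [f (x + r *: z) s] integrates to zero.
    The identity is stated without dividing by [r] so that it covers [r = 0]. *)
Lemma weighted_mean_is_derive f x r s : space_C 1 f ->
  exists2 l, is_derive r 1 (fun r => weighted_mean f x (r, s)) l &
    r * l = ball_mean f x (r, s) - (d%:R + 2) * weighted_mean f x (r, s).
Proof.
move=> Cf; eexists.
  exact: (ball_avg_is_derive_radius x r s weight_continuous Cf).
have cf : continuous (fun z : V => f (x + r *: z) s).
  by apply: comp_continuous; exact: (space_C_continuous Cf).
have cd i : continuous (fun z : V => partial i f (x + r *: z) s).
  by apply: comp_continuous; apply: space_C_continuous (space_C_partial i Cf).
have cz i : continuous (fun z : V => z 0 i) by exact: coord_continuous.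
have cw := weight_continuous.
have csum : continuous (fun z : V => weight z * \sum_(i < d) z 0 i * partial i f (x + r *: z) s).
  by apply: continuous_mul => //; apply: continuous_sum => i; exact: continuous_mul.
have c2 i : continuous (fun z : V => f (x + r *: z) s + z 0 i * (r * partial i f (x + r *: z) s)).
  apply: continuous_add => //; apply: continuous_mul => //.
  by apply: continuous_mul => //; exact: cst_continuous.
have c3 : continuous (fun z : V => weight z * f (x + r *: z) s) by exact: continuous_mul.
(* [ball_divergence] for the [i]-th component [z 0 i * f (x + r *: z) s]. *)
have div0 i : \int[mu]_(z in B) ((1 - sqnorm z) * (f (x + r *: z) s +
     z 0 i * (r * partial i f (x + r *: z) s)) - 2 * z 0 i * (z 0 i * f (x + r *: z) s)) = 0.
  apply: ball_divergence => //; first exact: continuous_mul.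
  move=> z; have dz : is_derive z (delta_mx 0 i : V) (fun z : V => z 0 i) 1.
    have zE : z = z + 0 *: delta_mx 0 i by rewrite scale0r addr0.
    rewrite [X in is_derive X _ _ _]zE; apply/(is_derive_line (fun z : V => z 0 i)).
    rewrite (_ : (fun b : R => _) = (fun b : R => z 0 i + b)); last first.
      by apply/funext => b; rewrite !mxE !eqxx mulr1.
    apply: (is_derive_eq (is_derive_addf (is_derive_cst (z 0 i) (0 : R) 1) (is_derive_id (0 : R) 1))).
    by rewrite add0r.
  apply: (is_derive_eq (is_derive_mulf dz (affine_derive i x r s z Cf))).
  by ring.
have csq : continuous (fun z : V => sqnorm z * f (x + r *: z) s).
  by apply: continuous_mul => //; exact: sqnorm_continuous.
have cdiv i : continuous (fun z : V => (1 - sqnorm z) * (f (x + r *: z) s +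
     z 0 i * (r * partial i f (x + r *: z) s)) - 2 * z 0 i * (z 0 i * f (x + r *: z) s)).
  apply: continuous_sub.
    apply: continuous_mul => //; apply: continuous_sub; first exact: cst_continuous.
    exact: sqnorm_continuous.
  apply: continuous_mul; last exact: continuous_mul.
  by apply: continuous_mul => //; exact: cst_continuous.
have := Rintegral_sum (index_enum 'I_d) mB (fun i => ball_integrable (cdiv i)).
rewrite big1 => [|i _]; last exact: div0.
rewrite /ball_mean /weighted_mean /ball_avg /= => S0.
rewrite -!RintegralZl//; [|exact: ball_integrable..].
have cf1 : continuous (fun z : V => cst 1 z * f (x + r *: z) s).
  by apply: continuous_mul => //; exact: cst_continuous.
have c4 : continuous (fun z : V => (d%:R + 2) * (weight z * f (x + r *: z) s)).
  by apply: continuous_mul => //; exact: cst_continuous.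
have c5 : continuous (fun z : V => r * (weight z * \sum_(i < d) z 0 i * partial i f (x + r *: z) s)).
  by apply: continuous_mul => //; exact: cst_continuous.
rewrite -RintegralB//; [|exact: ball_integrable..].
apply/eqP; rewrite -subr_eq0 -RintegralB//; last first.
  by apply: ball_integrable; exact: continuous_sub.
  exact: ball_integrable.
apply/eqP; rewrite -[RHS](mulr0 2^-1) -[in RHS]S0 -RintegralZl//; last first.
  by apply: ball_integrable; exact: continuous_sum.
apply: eq_Rintegral => z _.
rewrite sumrB -mulr_sumr big_split/= sumr_const card_ord -mulr_natl.
have -> : \sum_(i < d) z 0 i * (r * partial i f (x + r *: z) s) =
    r * \sum_(i < d) z 0 i * partial i f (x + r *: z) s.
  by rewrite mulr_sumr; apply: eq_bigr => i _; ring.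
have -> : \sum_(i < d) 2 * z 0 i * (z 0 i * f (x + r *: z) s) =
    2 * sqnorm z * f (x + r *: z) s.
  rewrite /sqnorm mulr_sumr mulr_suml; apply: eq_bigr => i _; ring.
by rewrite /weight; field.
Qed.

End ladder.

(** * The ladder of spherical means *)

Section radial_ladder.
Variables (R : realType) (d : nat).
Local Notation V := 'rV[R]_d.
Implicit Types (f : V -> R -> R) (x : V) (p : R * R) (r s : R).

(** Up to the factor [r ^+ (d - 2 k)], [ladder k.+1 f] is the [k]-th iterate of
    [r^-1 d/dr] on the integral of [f] over the ball of radius [r]. The recursion
    below avoids the division by [r] and all radial derivatives of [f]: by
    [ladder_is_derive] the term [p.1 ^+ 2 * ladder k' (lap f)] is the radius times
    the radial derivative of [ladder k'.+1 f]. Level [0] starts the recursion one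
    step early, where both identities are integrations by parts. *)
Fixpoint ladder (k : nat) f : V -> R * R -> R :=
  match k with
  | 0 => weighted_mean f
  | 1 => ball_mean f
  | (k'.+1 as k1).+1 => fun x p =>
      (d%:R - 2 * k'%:R) * ladder k1 f x p + p.1 ^+ 2 * ladder k' (lap f) x p
  end.

Lemma ladderSS k f : ladder k.+2 f = fun x p =>
  (d%:R - 2 * k%:R) * ladder k.+1 f x p + p.1 ^+ 2 * ladder k (lap f) x p.
Proof. by []. Qed.

Lemma nat_ind2 (Q : nat -> Prop) :
  Q 0%N -> Q 1%N -> (forall k, Q k -> Q k.+1 -> Q k.+2) -> forall k, Q k.
Proof.
move=> Q0 Q1 QSS k; suff [] : Q k /\ Q k.+1 by [].
by elim: k => [|k [Qk Qk1]]; split => //; exact: QSS.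
Qed.

Let sq1_continuous : continuous (fun p : R * R => p.1 ^+ 2).
Proof. by apply: continuous_exp; exact: fst_continuous. Qed.

Lemma ladder_space_C k n f : space_C (n + 2 * k) f -> space_C n (ladder k f).
Proof.
elim/nat_ind2: k n f => [|| k IHk IHk1] n f Cf.
- by apply: ball_avg_space_C; [exact: weight_continuous|apply: space_C_le Cf; lia].
- by apply: ball_avg_space_C; [exact: cst1_continuous|apply: space_C_le Cf; lia].
rewrite ladderSS; apply: space_CD.
  apply: (@space_CZ _ _ _ n (cst (d%:R - 2 * k%:R))); first exact: cst_continuous.
  by apply: IHk1; apply: space_C_le Cf; lia.
apply: (@space_CZ _ _ _ n (fun p : R * R => p.1 ^+ 2)) => //.
by apply/IHk/space_C_lap; apply: space_C_le Cf; lia.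
Qed.

Lemma lap_ladder k f : space_C (2 + 2 * k) f -> lap (ladder k f) = ladder k (lap f).
Proof.
elim/nat_ind2: k f => [|| k IHk IHk1] f Cf.
- by apply: lap_ball_avg; [exact: weight_continuous|apply: space_C_le Cf; lia].
- by apply: lap_ball_avg; [exact: cst1_continuous|apply: space_C_le Cf; lia].
have C1 : space_C 2 (ladder k.+1 f).
  by apply: ladder_space_C; apply: space_C_le Cf; lia.
have C0 : space_C 2 (ladder k (lap f)).
  by apply/ladder_space_C/space_C_lap; apply: space_C_le Cf; lia.
rewrite !ladderSS lapD.
- rewrite (lapZ (fun=> d%:R - 2 * k%:R) C1) (lapZ (fun p => p.1 ^+ 2) C0).
  rewrite IHk1; last by apply: space_C_le Cf; lia.
  have Cl : space_C (2 + 2 * k) (lap f).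
    by apply: space_C_lap; apply: space_C_le Cf; lia.
  by rewrite (IHk _ Cl).
- by apply: (@space_CZ _ _ _ 2 (cst (d%:R - 2 * k%:R))) => //; exact: cst_continuous.
- exact: (@space_CZ _ _ _ 2 (fun p : R * R => p.1 ^+ 2)).
Qed.

(** Darboux' equation. If it holds at two consecutive levels with coefficients
    [d - 2 k] and [d - 2 k.+1], the product rule gives it at the next one, since
    the derivative of [r ^+ 2] makes up for the difference [2]. *)
Lemma ladder_is_derive k f x r s : space_C (2 * k + 4) f ->
  is_derive r 1 (fun r => ladder k.+1 f x (r, s)) (r * ladder k (lap f) x (r, s)).
Proof.
have dsq : is_derive r 1 (fun r : R => r ^+ 2) (2 * r).
  by apply: (is_derive_eq (is_derive_expf 2 (is_derive_id r 1))); rewrite /=; ring.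
elim/nat_ind2: k f => [|| k IHk IHk1] f Cf.
- by apply: ball_mean_is_derive; apply: space_C_le Cf; lia.
- have Cl : space_C 1 (lap f) by apply: space_C_lap; apply: space_C_le Cf; lia.
  have [l dl lE] := weighted_mean_is_derive x r s Cl.
  have db := @ball_mean_is_derive _ _ f x r s (space_C_le _ Cf).
  apply: (is_derive_eq (is_derive_addf (is_derive_mulcf (d%:R - 2 * 0%N%:R) (db _))
    (is_derive_mulf dsq dl))); first by lia.
  have -> : ladder 1 (lap f) x (r, s) = r * l + (d%:R + 2) * weighted_mean (lap f) x (r, s).
    by rewrite lE subrK.
  by ring.
have D1 := IHk1 f (space_C_le _ Cf).
have D0 : is_derive r 1 (fun r => ladder k.+1 (lap f) x (r, s))
    (r * ladder k (lap (lap f)) x (r, s)).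
  by apply: IHk; apply: space_C_lap; apply: space_C_le Cf; lia.
apply: (is_derive_eq (is_derive_addf (is_derive_mulcf (d%:R - 2 * k.+1%:R) (D1 _))
  (is_derive_mulf dsq D0))); first by lia.
by rewrite ladderSS /= -natr1; ring.
Qed.

Lemma ladder_center k f x s : ladder k.+1 f x (0, s) =
  (\prod_(j < k) (d%:R - 2 * j%:R)) * ball_volume R d * f x s.
Proof.
elim: k => [|k IHk].
  rewrite big_ord0 mul1r /= /ball_mean /ball_avg /=.
  under eq_Rintegral do rewrite scale0r addr0 mul1r.
  by rewrite Rintegral_cst; [rewrite mulrC|exact: measurable_unit_ball].
by rewrite ladderSS IHk big_ord_recr/= expr0n/= mul0r addr0; ring.
Qed.

End radial_ladder.

(** * Integrals over the past of a point *)

Section integrals_over_the_past.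
Variables (R : realType) (d : nat) (rho P : R -> R).
Hypotheses (crho : continuous rho) (cP : continuous P).
Hypothesis dP : forall t : R, 0 < t -> is_derive t 1 P (rho t).
Local Notation V := 'rV[R]_d.
Local Notation ee i := (delta_mx 0 i : V).
Local Notation mu := (@lebesgue_measure R).

Section segment.
Variable t : R.

Let mI : measurable (`[0%R, t]%classic : set (measurableTypeR R)). Proof. exact: measurable_itv. Qed.
Let fI : (mu `[0%R, t]%classic < +oo)%E.
Proof. by rewrite lebesgue_measure_itv/=; case: ifPn => _; rewrite -?EFinB ltry. Qed.
Let cI : compact `[0, t]. Proof. exact: segment_compact. Qed.
Let subI : forall s, `[0, t]%classic s -> `[0, t]%classic s. Proof. by []. Qed.
Let mcont (g : R -> R) : continuous g -> measurable_fun `[0%R, t]%classic (g \o id).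
Proof. by move=> cg; exact: (measurable_funTS (continuous_measurable_fun cg)). Qed.

Lemma segment_integrable (g : R -> R) : continuous g ->
  mu.-integrable `[0, t] (EFin \o g).
Proof.
move=> cg; apply: continuous_compact_integrable; first exact: segment_compact.
exact: continuous_subspaceT.
Qed.

Lemma is_derive_segment (f df : R * R -> R) (a e : R) : 0 < e ->
  (forall (x : R) y, `|x - a| < e ->
    is_derive x 1 (fun x : R => f (x, y)) (df (x, y))) ->
  (forall x, continuous (fun y => f (x, y))) -> continuous df ->
  is_derive a 1 (fun x : R => \int[mu]_(y in `[0, t]) f (x, y))
    (\int[mu]_(y in `[0, t]) df (a, y)).
Proof.
move=> e0 fdf cf cdf.
exact: (is_derive_Rintegral mI fI cI subI mcont e0 fdf cf cdf).
Qed.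

Lemma segment_integral_bound (g : R -> R) (M : R) : 0 <= t -> continuous g ->
  (forall s, `[0, t]%classic s -> `|g s| <= M) ->
  `| \int[mu]_(s in `[0, t]) g s | <= M * t.
Proof.
move=> t0 cg gM; have := le_norm_Rintegral_bound mI fI cI subI mcont cg gM.
have -> // : fine (mu (`[0%R, t]%classic : set R)) = t.
rewrite lebesgue_measure_itv/= lte_fin; case: ifPn => [_|]; first by rewrite /= subr0.
by rewrite -leNgt => t0'; rewrite /=; apply/le_anti/andP.
Qed.

End segment.

(** [P t - P s] is the radius at time [s] of the backward cone with vertex at
    time [t]. *)
Definition past_integral (G : V -> R * R -> R) (x : V) (t : R) : R :=
  \int[mu]_(s in `[0, t]) G x (P t - P s, s).

Let path_continuous (T : topologicalType) (g : T -> V) (a b : T -> R) n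
    (G : V -> R * R -> R) :
  continuous g -> continuous a -> continuous b -> space_C n G ->
  continuous (fun q => G (g q) (P (a q) - P (b q), b q)).
Proof.
move=> cg ca cb /space_C_continuous cG.
apply: (@continuous_compose _ _ _ (fun q => (g q, (P (a q) - P (b q), b q)))
  (fun q => G q.1 q.2)) => //.
apply: continuous_pair => //; apply: continuous_pair => //.
by apply: continuous_sub; apply: continuous_compose cP.
Qed.

Let id_continuous (T : topologicalType) : continuous (@id T).
Proof. by move=> x; exact: cvg_id. Qed.

Lemma past_integrand_continuous n (G : V -> R * R -> R) x (t : R) : space_C n G ->
  continuous (fun s : R => G x (P t - P s, s)).
Proof.
move=> CG; exact: (path_continuous (@cst_continuous _ _ x) (@cst_continuous _ _ t)
  (@id_continuous R) CG).
Qed.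

Lemma past_integral_is_derive_space (G : V -> R * R -> R) i x t : space_C 1 G ->
  is_derive x (ee i) ((past_integral G)^~ t) (past_integral (partial i G) x t).
Proof.
move=> CG; have xE : x = x + 0 *: ee i by rewrite scale0r addr0.
rewrite [X in is_derive X _ _ _]xE.
have cline : continuous (fun q : R * R => x + q.1 *: ee i).
  apply: continuous_add; first exact: cst_continuous.
  by apply: continuous_scale; [exact: fst_continuous|exact: cst_continuous].
apply/(is_derive_line ((past_integral G)^~ t)).
rewrite {2}xE.
apply: (@is_derive_segment t
  (fun q : R * R => G (x + q.1 *: ee i) (P t - P q.2, q.2))
  (fun q : R * R => partial i G (x + q.1 *: ee i) (P t - P q.2, q.2)) 0 1 ltr01).
- move=> a s _ /=; apply: (is_derive_line (G^~ (P t - P s, s)) x (ee i) a _).1.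
  exact: (space_C_is_derive i _ _ CG).
- by move=> a; exact: (@past_integrand_continuous _ _ (x + a *: ee i) t CG).
- exact: (path_continuous cline (@cst_continuous _ _ t) (@snd_continuous R R)
    (space_C_partial i CG)).
Qed.

Lemma lap_past_integral (G : V -> R * R -> R) : space_C 2 G ->
  lap (past_integral G) = past_integral (lap G).
Proof.
move=> CG; apply/funext => x; apply/funext => t.
have part1 H i : space_C 1 H -> partial i (past_integral H) = past_integral (partial i H).
  by move=> CH; apply: partial_uniq => y s; exact: past_integral_is_derive_space.
transitivity (\sum_(i < d) past_integral (partial i (partial i G)) x t).
  apply: eq_bigr => i _; rewrite (part1 _ i (space_CW CG)).
  by rewrite (part1 _ i (space_C_partial i CG)).
have Ci i : continuous (fun s => partial i (partial i G) x (P t - P s, s)).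
  exact: (past_integrand_continuous (space_C_partial i (space_C_partial i CG))).
rewrite /past_integral /lap Rintegral_sum//.
by move=> i; exact: segment_integrable.
Qed.

(** Leibniz' rule: the moving endpoint contributes the value at radius zero, and
    the radius [P t - P s] grows at speed [rho t]. *)
Lemma past_integral_is_derive_time (G dG : V -> R * R -> R) x (t : R) : 0 < t ->
  (forall r s : R, is_derive r 1 (fun r : R => G x (r, s)) (dG x (r, s))) ->
  space_C 0 G -> space_C 0 dG ->
  is_derive t 1 (past_integral G x) (G x (0, t) + rho t * past_integral dG x t).
Proof.
move=> t0 dGr CG CdG.
pose q (ab : R * R) := G x (P ab.2 - P ab.1, ab.1).
have cq : continuous q.
  exact: (path_continuous (@cst_continuous _ _ x) (@snd_continuous R R)
    (@fst_continuous R R) CG).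
have Wa (a b : R) : `|a - t| < t -> is_derive a 1
    (fun a => \int[mu]_(s in `[0, a]) G x (P b - P s, s)) (q (a, b)).
  move=> at_; apply: (is_derive_integral_upper (f := fun s => G x (P b - P s, s))).
    exact: past_integrand_continuous CG.
  by move: at_; rewrite ltr_distl subrr => /andP[].
have cdq : continuous (fun q : R * R => rho q.1 * dG x (P q.1 - P q.2, q.2)).
  apply: continuous_mul; first exact: (continuous_compose (@fst_continuous R R) crho).
  exact: (path_continuous (@cst_continuous _ _ x) (@fst_continuous R R)
    (@snd_continuous R R) CdG).
have Wt : is_derive t 1 (fun b => \int[mu]_(s in `[0, t]) G x (P b - P s, s))
    (\int[mu]_(s in `[0, t]) (rho t * dG x (P t - P s, s))).
  apply: (@is_derive_segment t (fun q : R * R => G x (P q.1 - P q.2, q.2))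
    (fun q : R * R => rho q.1 * dG x (P q.1 - P q.2, q.2)) t t t0) => //.
    move=> b s bt /=.
    have b0 : 0 < b by move: bt; rewrite ltr_distl subrr => /andP[].
    have db : is_derive b 1 (fun b => P b - P s) (rho b).
      apply: (is_derive_eq (is_derive_addf (dP b0) (is_derive_cst (- P s) b 1))).
      by rewrite addr0.
    have := @is_derive1_comp _ (fun r => G x (r, s)) (fun b => P b - P s) b _ _
      (dGr _ _) db.
    by rewrite mulrC.
  by move=> b; exact: (@past_integrand_continuous _ _ x b CG).
have cdG : continuous (fun s : R => dG x (P t - P s, s)).
  exact: (@past_integrand_continuous _ _ x t CdG).
have idG := @segment_integrable t _ cdG.
have := is_derive_diagonal (W := fun a b => \int[mu]_(s in `[0, a]) G x (P b - P s, s))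
  t0 Wa (cq _) Wt.
rewrite (RintegralZl (rho t) _ idG); last exact: measurable_itv.
by rewrite {1}/q/= subrr.
Qed.

End integrals_over_the_past.

(** * The wave operator on cone means *)

Section half_derivative.
Variable R : realType.

Lemma within_half_line (t : R) : 0 < t ->
  within [set h | 0 <= h + t] (0 : R)^' = (0 : R)^'.
Proof.
move=> t0; apply/seteqP; split => A; last exact: filterS.
rewrite /within /= => HA.
have nt : \forall h \near (0 : R)^', 0 <= h + t.
  apply: (@cvg_within _ _ _).
  have : \forall h \near (0 : R), - t < h by apply: lt_nbhsr; rewrite oppr_lt0.
  by apply: filterS => h th; lra.
by apply: filterS2 nt HA => h h0; exact.
Qed.

Lemma half_derive_is_derive (f : R -> R) (t l : R) : 0 < t ->
  is_derive t 1 f l -> half_derive f t = l.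
Proof.
move=> t0 /is_derive1P fl; rewrite /half_derive /half_dquot within_half_line//.
by apply/cvg_lim => //; exact: Rhausdorff.
Qed.

Lemma half_derivable_is_derive (f : R -> R) (t : R) : 0 < t ->
  half_derivable f t -> is_derive t 1 f (half_derive f t).
Proof.
move=> t0 fl; apply/is_derive1P; move: fl.
by rewrite /half_derivable /half_derive /half_dquot within_half_line.
Qed.

End half_derivative.

Section wave_operator_on_cone_means.
Variables (R : realType) (d : nat) (rho P : R -> R).
Hypotheses (crho : continuous rho) (cP : continuous P).
Hypothesis rho_gt0 : forall t : R, 0 < t -> 0 < rho t.
Hypothesis dP : forall t : R, 0 < t -> is_derive t 1 P (rho t).
Local Notation V := 'rV[R]_d.
Local Notation mu := (@lebesgue_measure R).
Implicit Types (f : V -> R -> R) (x : V) (k p : nat).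

Definition cone_kernel k p f x (q : R * R) : R := q.1 ^+ p * ladder k f x q.

Definition cone_mean k p f : V -> R -> R := past_integral P (cone_kernel k p f).

Lemma cone_kernel_space_C n k p f : space_C (n + 2 * k) f ->
  space_C n (cone_kernel k p f).
Proof.
move=> Cf; apply: (@space_CZ _ _ _ n (fun q : R * R => q.1 ^+ p)).
  by apply: continuous_exp; exact: fst_continuous.
exact: ladder_space_C.
Qed.

Lemma lap_cone_mean (c : R) k p f : space_C (2 + 2 * k) f ->
  lap (fun x t => c * cone_mean k p f x t) = (fun x t => c * cone_mean k p (lap f) x t).
Proof.
move=> Cf.
have scaled g x t : space_C (2 * k) g ->
    c * cone_mean k p g x t = past_integral P (fun y q => c * cone_kernel k p g y q) x t.
  move=> Cg; have CG : space_C 0 (cone_kernel k p g) by exact: cone_kernel_space_C.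
  have iG := segment_integrable t (@past_integrand_continuous R d P cP 0 _ x t CG).
  rewrite /cone_mean /past_integral RintegralZl//.
have CK := @space_CZ _ _ _ 2 (fun _ : R * R => c) _ (@cst_continuous _ _ c)
  (cone_kernel_space_C (n := 2) p Cf).
transitivity (lap (past_integral P (fun y q => c * cone_kernel k p f y q))).
  congr lap; apply/funext => x; apply/funext => t; rewrite scaled//.
  by apply: space_C_le Cf; lia.
rewrite (lap_past_integral cP CK); apply/funext => x; apply/funext => t.
rewrite scaled; last by apply: space_C_lap; apply: space_C_le Cf; lia.
congr (past_integral P _ x t).
rewrite (lapZ (fun=> c) (cone_kernel_space_C p Cf)) /cone_kernel.
by rewrite (lapZ (fun q : R * R => q.1 ^+ p) (ladder_space_C Cf)) (lap_ladder Cf).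
Qed.

(** With [p.+1 = d - 2 k] the radial derivative of [r ^+ p.+1 * ladder k.+1 f] is
    [r ^+ p * ladder k.+2 f], by the recursion that defines the ladder. *)
Lemma cone_mean_is_derive k p f x (t : R) : 0 < t ->
  d%:R - 2 * k%:R = p.+1%:R :> R -> space_C (2 * k + 4) f ->
  is_derive t 1 (cone_mean k.+1 p.+1 f x) (rho t * cone_mean k.+2 p f x t).
Proof.
move=> t0 dk Cf.
have -> : rho t * cone_mean k.+2 p f x t =
    cone_kernel k.+1 p.+1 f x (0, t) + rho t * cone_mean k.+2 p f x t.
  by rewrite /cone_kernel expr0n/= mul0r add0r.
apply: (past_integral_is_derive_time crho cP dP t0 (G := cone_kernel k.+1 p.+1 f)).
- move=> r s.
  apply: (is_derive_eq (is_derive_mulf (is_derive_expf p.+1 (is_derive_id r 1))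
    (ladder_is_derive x r s Cf))).
  by rewrite /cone_kernel ladderSS dk /= !exprS; ring.
- by apply: cone_kernel_space_C; apply: space_C_le Cf; lia.
- by apply: cone_kernel_space_C; apply: space_C_le Cf; lia.
Qed.

Lemma cone_mean_is_derive2 k p f x (t : R) : 0 < t -> space_C (2 * k + 8) f ->
  is_derive t 1 (cone_mean k.+2 p f x)
    ((p == 0%N)%:R * ladder k.+2 f x (0, t) +
     rho t * (p%:R * cone_mean k.+2 p.-1 f x t + cone_mean k.+1 p.+1 (lap f) x t)).
Proof.
move=> t0 Cf.
have Cl : space_C (2 * k + 6) (lap f) by apply: space_C_lap; apply: space_C_le Cf; lia.
pose dG (y : V) (q : R * R) := p%:R * cone_kernel k.+2 p.-1 f y q +
  cone_kernel k.+1 p.+1 (lap f) y q.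
have C1 : space_C 0 (cone_kernel k.+2 p.-1 f).
  by apply: cone_kernel_space_C; apply: space_C_le Cf; lia.
have C2 : space_C 0 (cone_kernel k.+1 p.+1 (lap f)).
  by apply: cone_kernel_space_C; apply: space_C_le Cl; lia.
have C1' : space_C 0 (fun y q => p%:R * cone_kernel k.+2 p.-1 f y q).
  by apply: (@space_CZ _ _ _ 0 (fun _ : R * R => p%:R)) => //; exact: cst_continuous.
have i1 := segment_integrable t (@past_integrand_continuous R d P cP 0 _ x t C1).
have i1' := segment_integrable t (@past_integrand_continuous R d P cP 0 _ x t C1').
have i2 := segment_integrable t (@past_integrand_continuous R d P cP 0 _ x t C2).
have -> : p%:R * cone_mean k.+2 p.-1 f x t + cone_mean k.+1 p.+1 (lap f) x t =
    past_integral P dG x t.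
  rewrite /cone_mean /past_integral /dG -RintegralZl; [|exact: measurable_itv|exact: i1].
  by rewrite -RintegralD; [|exact: measurable_itv|exact: i1'|exact: i2].
have -> : (p == 0%N)%:R * ladder k.+2 f x (0, t) = cone_kernel k.+2 p f x (0, t).
  by rewrite /cone_kernel expr0n.
apply: (past_integral_is_derive_time crho cP dP t0 (G := cone_kernel k.+2 p f)).
- move=> r s.
  have Cf' : space_C (2 * k.+1 + 4) f by apply: space_C_le Cf; lia.
  apply: (is_derive_eq (is_derive_mulf (is_derive_expf p (is_derive_id r 1))
    (ladder_is_derive x r s Cf'))).
  rewrite /dG /cone_kernel; move: (ladder k.+2 f x (r, s)) => L2.
  by move: (ladder k.+1 _ _ _) => L1; rewrite /= exprS; ring.
- by apply: cone_kernel_space_C; apply: space_C_le Cf; lia.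
- exact: space_CD.
Qed.

Lemma lap_slice (w w' : V -> R -> R) x (t : R) :
  (forall y, w y t = w' y t) -> lap w x t = lap w' x t.
Proof.
move=> ww'; apply: eq_bigr => i _; rewrite /partial.
by have -> : w ^~ t = w' ^~ t by apply/funext.
Qed.

Lemma near_gt0_eq (g h : R -> R) (t : R) : 0 < t -> (forall s, 0 < s -> g s = h s) ->
  \near t, h t = g t.
Proof.
move=> t0 gh; near=> s; rewrite gh//; near: s; exact: lt_nbhsr.
Unshelve. all: by end_near. Qed.

(** The second time derivative of the mean at level [k] consists of the mean of
    [lap f], which the Laplacian cancels, and of [p] times the mean at level
    [k.+1]. The boundary term of Leibniz' rule survives only for [p = 0], that is
    at the last level in odd dimension. *)
Lemma wave_op_cone_mean (rho0 : R -> R) (w : V -> R -> R) (c : R) k p f x (t : R) :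
  (forall s, 0 <= s -> rho0 s = rho s) ->
  (forall y (s : R), 0 < s -> w y s = c * cone_mean k.+1 p.+1 f y s) ->
  d%:R - 2 * k%:R = p.+1%:R :> R -> space_C (2 * k + 8) f -> 0 < t ->
  wave_op rho0 w x t =
  c * (p%:R * cone_mean k.+2 p.-1 f x t + (p == 0%N)%:R * ladder k.+2 f x (0, t) / rho t).
Proof.
move=> rho0E wE dk Cf t0; rewrite /wave_op.
have Cf4 : space_C (2 * k + 4) f by apply: space_C_le Cf; lia.
have dtw y (s : R) : 0 < s -> dt w y s = c * (rho s * cone_mean k.+2 p f y s).
  move=> s0; apply: half_derive_is_derive => //.
  apply: (near_eq_is_derive (near_gt0_eq s0 (wE y))).
  exact/is_derive_mulcf/cone_mean_is_derive.
have -> : dt (fun y s => dt w y s / rho0 s) x t = c * ((p == 0%N)%:R * ladder k.+2 f x (0, t) +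
     rho t * (p%:R * cone_mean k.+2 p.-1 f x t + cone_mean k.+1 p.+1 (lap f) x t)).
  apply: half_derive_is_derive => //.
  apply: (near_eq_is_derive (f := fun s => c * cone_mean k.+2 p f x s)).
    apply: near_gt0_eq => // s s0; rewrite dtw// rho0E ?ltW//.
    by field; rewrite gt_eqF// rho_gt0.
  exact/is_derive_mulcf/cone_mean_is_derive2.
have -> : laplacian w x t = c * cone_mean k.+1 p.+1 (lap f) x t.
  transitivity (lap w x t); first by [].
  rewrite (@lap_slice w (fun y s => c * cone_mean k.+1 p.+1 f y s)); last first.
    by move=> y; exact: wE.
  by rewrite lap_cone_mean//; apply: space_C_le Cf; lia.
rewrite rho0E ?ltW//; field; by rewrite gt_eqF// rho_gt0.
Qed.

End wave_operator_on_cone_means.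

(** * The cone integral as a cone mean *)

Section cone_integral_as_mean.
Variables (R : realType) (d : nat) (rho P : R -> R).
Hypothesis cP : continuous P.
Hypothesis rho_gt0 : forall t : R, 0 < t -> 0 < rho t.
Hypothesis dP : forall t : R, 0 < t -> is_derive t 1 P (rho t).
Hypothesis intP : forall s t, 0 <= s -> s <= t ->
  \int[lebesgue_measure]_(tau in `[s, t]) rho tau = P t - P s.
Local Notation V := 'rV[R]_d.
Local Notation mu := (@lebesgue_measure R).
Local Notation la := (lebesgue_rV R d).

Lemma antiderivative_increasing (s t : R) : 0 <= s -> s < t -> 0 < P t - P s.
Proof.
move=> s0 st.
have dPst x : x \in `]s, t[ -> is_derive x 1 P (rho x).
  by rewrite in_itv/= => /andP[sx _]; apply: dP; lra.
have cPst : {within `[s, t], continuous P} by exact: continuous_subspaceT.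
have [c] := MVT st dPst cPst.
rewrite in_itv/= => /andP[sc _] ->.
by rewrite mulr_gt0 ?subr_gt0// rho_gt0//; lra.
Qed.

(* [rho0] and [alpha] are the data, [rho] and [a] extensions that are continuous
   at all times. *)
Variables (rho0 : R -> R) (alpha a : V -> R -> R).
Hypothesis rho0E : forall s, 0 <= s -> rho0 s = rho s.
Hypothesis alphaE : forall x s, 0 <= s -> alpha x s = a x s.
Hypothesis ca : continuous (fun q : V * R => a q.1 q.2).
Hypothesis a_ge0 : forall x s, 0 <= a x s.

Lemma past_coneE x (t : R) : past_cone rho0 x t =
  [set p : V * R | 0 < p.2 < t /\ sqnorm (p.1 - x) < (P t - P p.2) ^+ 2].
Proof.
rewrite /past_cone; apply/seteqP; split => -[y s] /= [st]; have /andP[s0 st'] := st.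
all: have Pst := antiderivative_increasing (ltW s0) st'.
all: have -> : \int[lebesgue_measure]_(tau in `[s, t]) rho0 tau = P t - P s
  by rewrite -intP ?ltW//; apply: eq_Rintegral => tau; rewrite inE/= in_itv/= => /andP[ts _];
     apply: rho0E; exact: le_trans (ltW s0) ts.
all: rewrite /euclidean_norm -/(sqnorm _) => H; split => //.
  rewrite -[X in X < _]sqr_sqrtr ?sqnorm_ge0// ltr_pXn2r// ?nnegrE ?sqrtr_ge0//.
  exact: ltW.
rewrite -(@ltr_pXn2r _ 2)// ?nnegrE ?sqrtr_ge0 ?(ltW Pst)//.
by rewrite sqr_sqrtr ?sqnorm_ge0.
Qed.

Lemma measurable_past_cone x (t : R) :
  measurable (past_cone rho0 x t : set (V * measurableTypeR R)).
Proof.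
rewrite past_coneE; apply: open_measurable_rV_prod.
pose h (p : V * R) := (P t - P p.2) ^+ 2 - sqnorm (p.1 - x).
have ch : continuous h.
  apply: continuous_sub.
    apply: continuous_exp; apply: continuous_sub; first exact: cst_continuous.
    exact: (continuous_compose (@snd_continuous V R) cP).
  apply: (@continuous_compose _ _ _ (fun p : V * R => p.1 - x) (@sqnorm R d)).
    by apply: continuous_sub; [exact: fst_continuous|exact: cst_continuous].
  exact: sqnorm_continuous.
rewrite (_ : mkset _ = (snd @^-1` `]0, t[) `&` (h @^-1` [set u | 0 < u])); last first.
  by apply/seteqP; split => -[y s]; rewrite /= in_itv/= /h subr_gt0.
apply: openI; apply: open_comp.
- by move=> p _; exact: snd_continuous.
- exact: interval_open.
- by move=> p _; exact: ch.
- exact: open_gt.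
Qed.

Lemma integral_ball_section x (r s : R) : 0 < r ->
  (\int[la]_y (if (sqnorm (y - x) < r ^+ 2)%R then (a y s)%:E else 0) =
  (r ^+ d * ball_mean a x (r, s))%:E)%E.
Proof.
move=> r0.
have cas : continuous (fun y : V => a y s).
  apply: (@continuous_compose _ _ _ (fun y : V => (y, s)) (fun q => a q.1 q.2)) => //.
  by apply: continuous_pair; [move=> ?; exact: cvg_id|exact: cst_continuous].
have mS : measurable [set y : V | sqnorm (y - x) < r ^+ 2].
  have cS : continuous (fun y : V => sqnorm (y - x)).
    apply: (@continuous_compose _ _ _ (fun y : V => y - x) (@sqnorm R d)).
      by apply: continuous_sub; [move=> ?; exact: cvg_id|exact: cst_continuous].
    exact: sqnorm_continuous.
  have := continuous_measurable_rV cS.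
  by move=> /(_ measurableT `]-oo, (r ^+ 2)[%classic (measurable_itv _)); rewrite setTI.
have E : (fun y => if sqnorm (y - x) < r ^+ 2 then (a y s)%:E else 0%E) =
    (EFin \o (a ^~ s)) \_ [set y : V | sqnorm (y - x) < r ^+ 2].
  apply/funext => y; rewrite patchE; case: ifPn => H; first by rewrite mem_set.
  by rewrite memNset//; exact/negP.
rewrite (@ge0_integral_rV_affine R d _ x r r0); last 2 first.
- have m1 : measurable_fun [set y : V | sqnorm (y - x) < r ^+ 2] (EFin \o (a ^~ s)).
    by apply/measurable_EFinP; exact: (measurable_funTS (continuous_measurable_rV cas)).
  by rewrite E; exact: ((measurable_restrictT _ mS).1 m1).
- by move=> y; case: ifP => // _; rewrite lee_fin.
rewrite EFinM; congr (_ * _)%E.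
have cint : continuous (fun z : V => cst 1 z * a (x + (r, s).1 *: z) (r, s).2).
  exact: (ball_avg_integrand_continuous (@cst1_continuous R d)).
rewrite /ball_mean /ball_avg /Rintegral fineK; last first.
  apply: integrable_fin_num; first exact: measurable_unit_ball.
  exact: ball_integrable.
rewrite [RHS]integral_mkcond; apply: eq_integral => z _.
rewrite patchE addrAC subrr add0r /= mul1r.
have -> : (sqnorm (r *: z) < r ^+ 2) = (z \in @unit_ball R d).
  rewrite /sqnorm; under eq_bigr do rewrite mxE exprMn.
  rewrite -mulr_sumr gtr_pMr ?exprn_gt0//.
  by apply/idP/idP; rewrite inE.
by case: ifP.
Qed.

(** Tonelli slices the cone by time; the slice at time [s] is the ball of centre
    [x] and radius [P t - P s]. Tonelli applies
    because the source is nonnegative. *)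
Lemma cone_integralE x (t : R) : cone_integral rho0 alpha x t = cone_mean P 1 d a x t.
Proof.
pose F (p : V * measurableTypeR R) : \bar R :=
  ((fun p => (a p.1 p.2)%:E) \_ (past_cone rho0 x t)) p.
have mF : measurable_fun setT F.
  have m1 : measurable_fun (past_cone rho0 x t : set (V * measurableTypeR R))
      (EFin \o (fun p : V * measurableTypeR R => a p.1 p.2)).
    apply/measurable_EFinP; exact: (measurable_funTS (continuous_measurable_rV_prod ca)).
  exact: ((measurable_restrictT _ (measurable_past_cone x t)).1 m1).
have F0 p : (0 <= F p)%E by rewrite /F patchE; case: ifP => // _; rewrite lee_fin.
have -> : cone_integral rho0 alpha x t = fine (\int[(la \x mu)%E]_p F p).
  rewrite /cone_integral /Rintegral [in LHS]integral_mkcond; congr fine.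
  apply: eq_integral => p _; rewrite /F !patchE; case: ifP => //.
  by rewrite inE => -[/andP[p0 _] _]; rewrite /= alphaE// ltW.
rewrite (fubini_tonelli2 F)// /cone_mean /past_integral /Rintegral; congr fine.
have cK : continuous (fun s : R => cone_kernel 1 d a x (P t - P s, s)).
  have CK : space_C 0 (cone_kernel 1 d a).
    apply: (@space_CZ _ _ _ 0 (fun q : R * R => q.1 ^+ d)).
      by apply: continuous_exp; exact: fst_continuous.
    by apply: ball_avg_space_C => //; exact: cst1_continuous.
  exact: (@past_integrand_continuous R d P cP 0 _ x t CK).
rewrite (@integral_itv_bndoo _ _ _ _ true false); last first.
  apply/measurable_EFinP; apply: measurable_funTS; exact: continuous_measurable_fun.
rewrite [RHS]integral_mkcond; apply: eq_integral => s _.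
rewrite patchE /fubini_G; case: ifPn => [|].
  rewrite inE/= in_itv/= => /andP[s0 st].
  rewrite -(integral_ball_section x s (antiderivative_increasing (ltW s0) st)).
  apply: eq_integral => y _; rewrite /F patchE past_coneE.
  have -> // : ((y, s) \in [set p : V * R | 0 < p.2 < t /\
      sqnorm (p.1 - x) < (P t - P p.2) ^+ 2]) = (sqnorm (y - x) < (P t - P s) ^+ 2).
  by apply/idP/idP => [|H]; [rewrite inE/= => -[]|rewrite inE/= s0].
rewrite notin_setE/= in_itv/= => H; apply: integral0_eq => y _.
by rewrite /F patchE past_coneE memNset//= => -[].
Qed.

End cone_integral_as_mean.

(** * Initial data *)

Section vanishing_derivatives.
Variable R : realType.

(** Taylor's formula at the left endpoint, by iterating L'Hopital's rule from the
    [n]-th derivative down. *)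
Lemma cvg_quotient_factorial (f : nat -> R -> R) (n i : nat) :
  (i <= n)%N ->
  (forall j (t : R), (j < n)%N -> 0 < t -> is_derive t 1 (f j) (f j.+1 t)) ->
  (forall j, (j <= n)%N -> f j t @[t --> 0^'+] --> f j 0) ->
  (forall j, (j < n)%N -> f j 0 = 0) ->
  f (n - i)%N t / t ^+ i @[t --> 0^'+] --> f n 0 / i`!%:R.
Proof.
move=> + fd fc f0; elim: i => [_|i IHi ilt].
  rewrite subn0 fact0 divr1; apply: cvg_trans (fc n (leqnn n)).
  by apply: near_eq_cvg; near=> t; rewrite expr0 divr1.
have e1 : (n - i = (n - i.+1).+1)%N by lia.
apply: (@lhopital_at_right R (f (n - i.+1)%N) (f (n - i)%N) (fun t => t ^+ i.+1)
  (fun t => i.+1%:R * t ^+ i) 0 1 _ ltr01).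
- by move=> t; rewrite in_itv/= => /andP[t0 _]; rewrite e1; apply: fd => //; lia.
- move=> t _; apply: (is_derive_eq (is_derive_expf i.+1 (is_derive_id t 1))).
  by rewrite mulr1.
- have := fc (n - i.+1)%N; rewrite f0; last by lia.
  by apply; lia.
- have : (t : R) ^+ i.+1 @[t --> (0 : R)] --> (0 : R) ^+ i.+1 by exact: exprn_continuous.
  by rewrite expr0n/=; exact: cvg_at_right_filter.
- by move=> t; rewrite in_itv/= => /andP[t0 _]; rewrite mulf_neq0 ?pnatr_eq0// expf_neq0// gt_eqF.
have -> : f n 0 / i.+1`!%:R = i.+1%:R^-1 * (f n 0 / i`!%:R).
  by rewrite factS natrM invfM; ring.
have H : i.+1%:R^-1 * (f (n - i)%N t / t ^+ i) @[t --> 0^'+] -->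
    i.+1%:R^-1 * (f n 0 / i`!%:R) by apply: cvgMl_tmp; exact: IHi (ltnW ilt).
apply: cvg_trans H; apply: near_eq_cvg; near=> t; rewrite invfM; ring.
Unshelve. all: by end_near. Qed.

(** A first nonzero derivative of order [j <= n] would make [f 0 t / t ^+ j]
    converge to a nonzero limit, against the bound. *)
Lemma derivatives_vanish (f : nat -> R -> R) (n : nat) (C : R) :
  (forall j (t : R), (j < n)%N -> 0 < t -> is_derive t 1 (f j) (f j.+1 t)) ->
  (forall j, (j <= n)%N -> f j t @[t --> 0^'+] --> f j 0) ->
  (forall t, 0 < t -> t <= 1 -> `|f 0%N t| <= C * t ^+ n.+1) ->
  forall j, (j <= n)%N -> f j 0 = 0.
Proof.
move=> fd fc fC; elim/ltn_ind => j IHj jn.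
have H := @cvg_quotient_factorial f j j (leqnn j) (fun i t ij => fd i t (leq_trans ij jn))
  (fun i ij => fc i (leq_trans ij jn))
  (fun i ij => IHj i ij (ltnW (leq_trans ij jn))).
rewrite subnn in H.
have C0 : 0 <= C by have := fC 1 ltr01 (lexx 1); rewrite expr1n mulr1; exact: le_trans.
have {}H : f j 0 / j`!%:R = 0.
  apply: (@cvg_unique _ (@Rhausdorff R) _ _ _ _ H).
  apply: (@squeeze_cvgr _ _ _ _ (fun t => - (C * t)) (fun t => C * t)).
  - near=> t.
    have t0 : 0 < t by near: t; exact: nbhs_right_gt.
    have t1 : t <= 1 by near: t; exact: nbhs_right_le.
    rewrite -ler_norml normrM normfV (gtr0_norm (exprn_gt0 j t0)).
    rewrite ler_pdivrMr ?exprn_gt0// (le_trans (fC t t0 t1))// -mulrA ler_wpM2l//.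
    by rewrite -exprS ler_wiXn2l// ltW.
  - apply: cvg_at_right_filter; rewrite -[X in _ --> X]oppr0; apply: cvgN.
    by rewrite -[X in _ --> X](mulr0 C); apply: cvgMl_tmp; exact: cvg_id.
  - apply: cvg_at_right_filter.
    by rewrite -[X in _ --> X](mulr0 C); apply: cvgMl_tmp; exact: cvg_id.
by move/eqP: H; rewrite mulf_eq0 invr_eq0 pnatr_eq0 (gtn_eqF (fact_gt0 j)) orbF => /eqP.
Unshelve. all: by end_near. Qed.

End vanishing_derivatives.

(** * From the half-space to all times *)

Section half_space_regularity.
Variables (R : realType) (d : nat).
Local Notation V := 'rV[R]_d.
Implicit Types (w : V -> R -> R).

Lemma within_continuous_compose (S T U : topologicalType) (A : set T) (f : T -> U)
    (g : S -> T) (F : set_system S) (t : T) : Filter F ->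
  {within A, continuous f} -> A t -> g @ F --> t -> (\forall s \near F, A (g s)) ->
  f (g s) @[s --> F] --> f t.
Proof.
move=> FF /subspace_continuousP/(_ _) cf At gt FA U' /cf - /(_ At) fU.
have := gt _ fU; rewrite /= /fmap /=; apply: filterS2 FA => s As /=; exact.
Qed.

(** Freezing the data before time zero gives functions continuous at all times,
    with the same spatial derivatives; the values at negative times never enter
    the cone. *)
Definition extend_past w (x : V) (t : R) : R := w x (Num.max t 0).

Lemma max0_continuous : continuous (fun t : R => Num.max t 0).
Proof. by move=> t; apply: continuous_max; [exact: cvg_id|exact: cvg_cst]. Qed.

Lemma max0_ge0 (t : R) : 0 <= Num.max t 0.
Proof. by rewrite le_max lexx orbT. Qed.

Lemma extend_past_space_C N w : half_space_C N w -> space_C N (extend_past w).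
Proof.
have cmax : continuous (fun q : V * R => (q.1, Num.max q.2 0)).
  apply: continuous_pair; first exact: fst_continuous.
  exact: (continuous_compose (@snd_continuous V R) max0_continuous).
have cext v : {within [set p : V * R | 0 <= p.2], continuous (fun p => v p.1 p.2)} ->
    continuous (fun q : V * R => extend_past v q.1 q.2).
  move=> cv q; apply: (@within_continuous_compose _ _ _ _ (fun p : V * R => v p.1 p.2)
    (fun q : V * R => (q.1, Num.max q.2 0)) (nbhs q) (q.1, Num.max q.2 0) _ cv).
  - exact: max0_ge0.
  - exact: cmax.
  - by apply: nearW => p; exact: max0_ge0.
elim: N w => [|N IHN] w [/cext cew Hw]; first by split.
have [_ dw _ Cw] := Hw.
split=> //; split; first by move=> i x t; exact: (dw i x _ (max0_ge0 t)).
by move=> i; exact: (IHN _ (Cw i)).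
Qed.

Lemma extend_past_line N (rho : R -> R) : half_line_C N rho ->
  continuous (fun t : R => rho (Num.max t 0)).
Proof.
move=> Cr; have cr : {within [set t | 0 <= t], continuous rho} by case: N Cr => [|N] [].
move=> t; apply: (@within_continuous_compose _ _ _ _ rho (fun t : R => Num.max t 0)
  (nbhs t) (Num.max t 0) _ cr).
- exact: max0_ge0.
- exact: max0_continuous.
- by apply: nearW => s; exact: max0_ge0.
Qed.

Lemma half_space_C_iter_dt N j w : (j <= N)%N -> half_space_C N w ->
  half_space_C (N - j) (iter j dt w).
Proof.
move=> + Cw; elim: j => [|j IHj] jN; first by rewrite subn0.
have := IHj (ltnW jN); have -> : (N - j = (N - j.+1).+1)%N by lia.
by case=> _ [].
Qed.

Lemma half_space_C_right_continuous N w x : half_space_C N w ->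
  w x t @[t --> 0^'+] --> w x 0.
Proof.
move=> Cw; have cw : {within [set p : V * R | 0 <= p.2], continuous (fun p => w p.1 p.2)}.
  by case: N Cw => [|N] [].
apply: (@within_continuous_compose _ _ _ _ (fun p : V * R => w p.1 p.2)
  (fun t : R => (x, t)) 0^'+ (x, 0 : R) _ cw) => //=.
- have cg : continuous (fun t : R => (x, t)).
    by apply: continuous_pair; [exact: cst_continuous|move=> ?; exact: cvg_id].
  exact: cvg_at_right_filter (cg 0).
- by near=> t; apply: ltW; near: t; exact: nbhs_right_gt.
Unshelve. all: by end_near. Qed.

Lemma half_space_C_is_derive N w x (t : R) : half_space_C N.+1 w -> 0 < t ->
  is_derive t 1 (w x) (dt w x t).
Proof.
move=> [_ [dw _ _ _]] t0; apply: half_derivable_is_derive => //.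
exact: (dw x t (ltW t0)).
Qed.

End half_space_regularity.

(** * Short-time bound and constants *)

Section short_time_bound.
Variables (R : realType) (d : nat) (rho P : R -> R).
Hypotheses (crho : continuous rho) (cP : continuous P).
Hypothesis dP : forall t : R, 0 < t -> is_derive t 1 P (rho t).
Local Notation V := 'rV[R]_d.

(** The radius at time [s] is at most a constant times [t], which gives the power
    [d]; the length of the time interval gives one more. *)
Lemma cone_mean_bound (a : V -> R -> R) (x : V) : space_C 0 a ->
  exists C, forall t : R, 0 < t -> t <= 1 -> `|cone_mean P 1 d a x t| <= C * t ^+ d.+1.
Proof.
move=> Ca.
have c01 : compact `[0 : R, 1] by exact: segment_compact.
have [Mr HMr] := continuous_bounded_on_compact c01 crho.
have Cb : space_C 0 (ball_mean a) by apply: ball_avg_space_C => //; exact: cst1_continuous.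
have cb : continuous (fun q : R * R => ball_mean a x (P q.1 - P q.2, q.2)).
  apply: (@continuous_compose _ _ _ (fun q : R * R => (x, (P q.1 - P q.2, q.2)))
    (fun q => ball_mean a q.1 q.2)); last exact: (space_C_continuous Cb).
  apply: continuous_pair; first exact: cst_continuous.
  apply: continuous_pair; last exact: snd_continuous.
  apply: continuous_sub.
    exact: (continuous_compose (@fst_continuous R R) cP).
  exact: (continuous_compose (@snd_continuous R R) cP).
have [Mb HMb] := continuous_bounded_on_compact (compact_setX c01 c01) cb.
have I0 : `[0 : R, 1]%classic 0 by rewrite /= in_itv/= lexx ler01.
have Mr0 : 0 <= Mr := le_trans (normr_ge0 _) (HMr 0 I0).
have Mb0 : 0 <= Mb := le_trans (normr_ge0 _) (HMb (0, 0) (conj I0 I0)).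
exists (Mr ^+ d * Mb) => t t0 t1.
have dist_le s : 0 <= s -> s <= t -> `|P t - P s| <= Mr * t.
  move=> s0 st.
  have dPs y : y \in `]s, t[ -> is_derive y 1 P (rho y).
    by rewrite in_itv/= => /andP[sy _]; apply: dP; exact: le_lt_trans sy.
  have cPs : {within `[s, t], continuous P} by exact: continuous_subspaceT.
  have [c] := MVT_segment st dPs cPs.
  rewrite in_itv/= => /andP[sc ct] ->; rewrite normrM ler_pM//.
    by apply: HMr; rewrite /= in_itv/= (le_trans s0 sc)/=; exact: le_trans ct t1.
  by rewrite ger0_norm ?subr_ge0// gerBl.
have CK : space_C 0 (cone_kernel 1 d a).
  apply: (@space_CZ _ _ _ 0 (fun q : R * R => q.1 ^+ d)); last exact: Cb.
  by apply: continuous_exp; exact: fst_continuous.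
have cK := @past_integrand_continuous R d P cP 0 _ x t CK.
rewrite exprS mulrCA mulrC [X in X * t](_ : _ = (Mr * t) ^+ d * Mb); last first.
  by rewrite exprMn; ring.
rewrite /cone_mean /past_integral; apply: segment_integral_bound; [exact: ltW|exact: cK|].
move=> s; rewrite /= in_itv/= => /andP[s0 st].
rewrite /cone_kernel normrM normrX ler_pM ?exprn_ge0//.
  by apply: lerXn2r; rewrite ?nnegrE ?mulr_ge0 ?(ltW t0)//; exact: dist_le.
apply: (HMb (t, s)); split; rewrite /= in_itv/= ?s0 ?(ltW t0)//=.
exact: le_trans st t1.
Qed.

End short_time_bound.

Section constants.
Variable R : realType.

Lemma double_fact_prod m : (double_fact (2 * m))%:R = \prod_(j < m) (2 * (m - j))%:R :> R.
Proof.
elim: m => [|m IHm]; first by rewrite big_ord0.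
rewrite big_ord_recl subn0; have -> : (2 * m.+1 = (2 * m).+2)%N by rewrite mulnS.
by rewrite natrM IHm.
Qed.

Lemma odd_prod m d : d = (2 * m + 1)%N ->
  \prod_(j < m.+1) (d%:R - 2 * j%:R) = \prod_(k < m.+1) (2 * k + 1)%:R :> R.
Proof.
move=> ->; rewrite (reindex_inj rev_ord_inj)/=; apply: eq_bigr => j _.
have jm : (j <= m)%N by rewrite -ltnS.
rewrite subSS natrB//.
by rewrite !natrD; ring.
Qed.

End constants.

Theorem theorem2p1 (R : realType) (m d : nat) (d_odd : d = (2 * m + 1)%N) :
  exists N : nat,
  forall (alpha : 'rV[R]_d -> R -> R) (rho : R -> R)
    (u := cone_integral rho alpha),
    half_space_C N u -> half_space_C N alpha -> half_line_C N rho ->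
    (forall x (t : R), 0 <= t -> 0 <= u x t) ->
    (forall x (t : R), 0 <= t -> 0 <= alpha x t) ->
    (forall t : R, 0 <= t -> 0 < rho t) ->
    (forall x (t : R), 0 < t ->
       iter m.+1 (wave_op rho) u x t =
       (double_fact (2 * m)%N)%:R * 2 ^+ m.+1 * pi ^+ m * (alpha x t / rho t)) /\
    (forall (j : nat) x, (j <= 2 * m + 1)%N -> iter j dt u x 0 = 0).
Proof.
exists (2 * m + 8)%N => alpha rho0 u Cu Calpha Crho _ alpha0 rho0_gt0.
pose rho (t : R) := rho0 (Num.max t 0).
pose a := extend_past alpha.
have crho : continuous rho := extend_past_line Crho.
have Ca : space_C (2 * m + 8) a := extend_past_space_C Calpha.
have rho0E t : 0 <= t -> rho0 t = rho t by move=> t0; rewrite /rho (max_idPl t0).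
have aE x t : 0 <= t -> alpha x t = a x t by move=> t0; rewrite /a/extend_past (max_idPl t0).
have rho_gt0 t : 0 < t -> 0 < rho t by move=> t0; rewrite -rho0E ?ltW// rho0_gt0// ltW.
have a_ge0 x t : 0 <= a x t by apply: alpha0; exact: max0_ge0.
have [P [cP dP intP]] := half_line_antiderivative crho.
have uE x t : u x t = cone_mean P 1 d a x t.
  exact: (cone_integralE cP rho_gt0 dP intP rho0E aE (space_C_continuous Ca) a_ge0).
split=> [x t t0|j x jm].
  have iterE k : (k <= m)%N -> forall y (s : R), 0 < s -> iter k (wave_op rho0) u y s =
      (\prod_(j < k) (2 * (m - j))%:R) * cone_mean P k.+1 (2 * (m - k)).+1 a y s.
    elim: k => [_|k IHk km] y s s0.
      have -> : (2 * (m - 0)).+1 = d by lia.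
      by rewrite big_ord0 mul1r /= uE.
    rewrite iterS (wave_op_cone_mean crho cP rho_gt0 dP y rho0E (IHk (ltnW km)) _ _ s0).
    - have -> : (2 * (m - k) == 0)%N = false by lia.
      rewrite mul0r mul0r addr0 mulrA big_ord_recr/=; congr (_ * cone_mean P _ _ _ _ _).
      lia.
    - have -> : (2 * (m - k)).+1 = (d - 2 * k)%N by lia.
      by rewrite natrB ?natrM//; lia.
    - by apply: space_C_le Ca; lia.
  rewrite iterS (wave_op_cone_mean crho cP rho_gt0 dP x rho0E (iterE m (leqnn m)) _ _ t0).
  - rewrite subnn muln0 mul0r add0r eqxx mul1r -double_fact_prod ladder_center.
    have -> : ball_volume R d = ball_volume R (2 * m + 1) by rewrite d_odd.
    rewrite (odd_prod _ d_odd) odd_ball_volume aE ?ltW// rho0E ?ltW//.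
    by rewrite !mulrA.
  - have -> : (2 * (m - m)).+1 = (d - 2 * m)%N by lia.
    by rewrite natrB ?natrM//; lia.
  - exact: Ca.
have [C HC] := cone_mean_bound crho cP dP x (space_C_le (leq0n _) Ca).
apply: (@derivatives_vanish _ (fun i => iter i dt u x) (2 * m + 1) C) jm.
- move=> i t im t0; have Ci := half_space_C_iter_dt (j := i) _ Cu.
  apply: (@half_space_C_is_derive _ _ (2 * m + 8 - i.+1)) => //.
  have -> : ((2 * m + 8 - i.+1).+1 = 2 * m + 8 - i)%N by lia.
  by apply: Ci; lia.
- move=> i im; apply: half_space_C_right_continuous.
  by apply: half_space_C_iter_dt Cu; lia.
- by move=> t t0 t1; rewrite /= uE -d_odd; exact: HC.
Qed.
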